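(* $$\lim_{k\to\infty}\sigma(k\text{-Hitting Set}/n)\le\lim_{k\to\infty}\sigma(k\text{-Set Splitting}/n).$$
   Context: For a problem $\Pi$ with input size $m$ and parameter $n$, $\sigma(\Pi/n)$ is the infimum of all $\epsilon>0$ such that $\Pi$ has a randomized algorithm with error probability at most $1/3$ running in time $2^{\epsilon n}\mathrm{poly}(m)$. $k$-Hitting Set: given an integer $t$ and $\mathcal F\subseteq 2^U$ with $|U|=n$, all sets of size at most $k$, decide whether there is $H\subseteq U$, $|H|\le t$, with $H\cap S\ne\emptyset$ for all $S\in\mathcal F$. $k$-Set Splitting: given $\mathcal F\subseteq 2^U$ with $|U|=n$, all sets of size at most $k$, decide whether there is $X\subseteq U$ such that for every $S\in\mathcal F$, $S\not\subseteq X$ and $S\not\subseteq U\setminus X$. *)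

(* Defs.v *)
From Corelib Require Import BinNums.
From HB Require Import structures.
From mathcomp Require Import all_boot all_order all_algebra.
From mathcomp Require Import all_classical all_reals all_analysis.

Set Implicit Arguments.
Unset Strict Implicit.
Unset Printing Implicit Defensive.

Import Order.TTheory GRing.Theory Num.Theory.
Import numFieldNormedType.Exports.

Local Open Scope ring_scope.

(** * Machine model

   Algorithms are programs of the WHILE language over binary trees (N. D. Jones,
   "Computability and Complexity"), extended with a coin toss.  Trees are
   immutable, so an implementation by pointers into a shared heap executes every
   basic operation in constant time; conversely a RAM memory is kept in a trie,
   with a logarithmic overhead per access.  Hence a running time T corresponds,
   in both directions, to T * poly(log T + log m) on a logarithmic-cost RAM, and
   being solvable in time 2 ^ (e * n) * poly(m) does not depend on which of
   these two models is chosen. *)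

Inductive tree : Type := leaf | node of tree & tree.

Definition is_leaf (u : tree) : bool := if u is leaf then true else false.
Definition left_of (u : tree) : tree := if u is node a _ then a else leaf.
Definition right_of (u : tree) : tree := if u is node _ b then b else leaf.

Fixpoint tree_size (u : tree) : nat :=
  if u is node a b then (tree_size a + tree_size b).+1 else 1%N.

Inductive expr : Type :=
  | Leaf
  | Var of nat
  | Node of expr & expr
  | Left of expr
  | Right of expr.

Inductive cmd : Type :=
  | Assign of nat & expr
  | Toss of nat
  | Seq of cmd & cmd
  | If of expr & cmd & cmd
  | While of expr & cmd.

Definition store : Type := nat -> tree.

Definition update (s : store) (x : nat) (u : tree) : store :=
  fun y => if y == x then u else s y.

Fixpoint eval (s : store) (e : expr) : tree :=
  match e with
  | Leaf => leaf
  | Var x => s x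
  | Node e1 e2 => node (eval s e1) (eval s e2)
  | Left e1 => left_of (eval s e1)
  | Right e1 => right_of (eval s e1)
  end.

Definition enc_bool (b : bool) : tree := if b then node leaf leaf else leaf.

(* The commands that remain to be executed, and the current store. *)
Definition config : Type := (seq cmd * store)%type.

Definition halted (c : config) : bool := nilp c.1.

(* As for a probabilistic Turing machine with two transition functions, every
   step receives a fresh random bit b; only [Toss] looks at it.  In tests,
   [leaf] is false and every other tree is true. *)
Definition step (c : config) (b : bool) : config :=
  let: (q, s) := c in
  match q with
  | [::] => (q, s)
  | Assign x e :: q' => (q', update s x (eval s e))
  | Toss x :: q' => (q', update s x (enc_bool b))
  | Seq c1 c2 :: q' => ([:: c1, c2 & q'], s)
  | If e c1 c2 :: q' => ((if is_leaf (eval s e) then c2 else c1) :: q', s)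
  | While e c1 :: q' =>
      (if is_leaf (eval s e) then q' else [:: c1, While e c1 & q'], s)
  end.

(* Input and output are in variable 0; all other variables start as [leaf]. *)
Definition init (A : cmd) (input : tree) : config :=
  ([:: A], update (fun=> leaf) 0 input).

Definition run (A : cmd) (input : tree) (bits : seq bool) : config :=
  foldl step (init A input) bits.

Definition accepts (c : config) : bool := ~~ is_leaf (c.2 0%N).

(** * Parameterized decision problems and their exponents *)

Record problem : Type := Problem {
  instance : Type;
  legal : instance -> bool;
  encode : instance -> tree;
  param : instance -> nat;
  answer : instance -> bool
}.

Definition input_size (P : problem) (I : instance P) : nat :=
  tree_size (encode I).

Definition halts_within (P : problem) (A : cmd) (I : instance P) (T : nat) :
    Prop :=
  forall r : T.-tuple bool, halted (run A (encode I) r).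

(* Meaningful when [halts_within A I T] holds, and then independent of T. *)
Definition error_prob (R : realType) (P : problem) (A : cmd) (I : instance P)
    (T : nat) : R :=
  #|[set r : T.-tuple bool | accepts (run A (encode I) r) != answer I]|%:R
    / 2 ^+ T.

Definition solvable_with_exponent (R : realType) (P : problem) (e : R) : Prop :=
  exists (A : cmd) (p : {poly nat}),
    forall I : instance P, legal I ->
      exists T : nat,
        [/\ T%:R <= 2 `^ (e * (param I)%:R) * (p.[input_size I])%:R :> R,
            halts_within A I T
          & error_prob R A I T <= 1 / 3].

(* The infimum is taken in the extended reals, so that it is +oo, and not 0,
   over the empty set. *)
Definition sigma (R : realType) (P : problem) : \bar R :=
  ereal_inf [set e%:E | e in [set e : R | 0 < e /\ solvable_with_exponent P e]].

(** * Encodings *)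

Fixpoint enc_seq (us : seq tree) : tree :=
  if us is u :: us' then node u (enc_seq us') else leaf.

Definition enc_unary (n : nat) : tree := enc_seq (nseq n leaf).

Fixpoint bits_of_pos (p : positive) : seq bool :=
  match p with
  | xH => [:: true]
  | xO p' => false :: bits_of_pos p'
  | xI p' => true :: bits_of_pos p'
  end.

Definition bits_of_nat (n : nat) : seq bool :=
  if bin_of_nat n is Npos p then bits_of_pos p else [::].

(* Sign, then the absolute value in binary, least significant bit first. *)
Definition enc_int (t : int) : tree :=
  node (enc_bool (t < 0)) (enc_seq (map enc_bool (bits_of_nat `|t|%N))).

(** * Hitting Set and Set Splitting

   The universe U is 'I_n.  In the input a set is a list of its elements and a
   family is a list of such lists, in any order and possibly with repetitions.
   The universe is part of the input, hence n <= m; so the unary element names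
   change the input size only polynomially. *)

Definition family_of (n : nat) (L : seq (seq 'I_n)) : {set {set 'I_n}} :=
  [set S in [seq [set x in s] | s <- L]].

Definition enc_family (n : nat) (L : seq (seq 'I_n)) : tree :=
  node (enc_unary n)
    (enc_seq [seq enc_seq [seq enc_unary x | x : 'I_n <- s] | s <- L]).

Definition sets_of_size_at_most (k n : nat) (F : {set {set 'I_n}}) : bool :=
  [forall S in F, (#|S| <= k)%N].

Definition has_hitting_set (n : nat) (F : {set {set 'I_n}}) (t : int) : bool :=
  [exists H : {set 'I_n},
    (#|H|%:Z <= t) && [forall S in F, H :&: S != finset.set0]].

Definition has_splitting (n : nat) (F : {set {set 'I_n}}) : bool :=
  [exists X : {set 'I_n},
    [forall S in F, ~~ (S \subset X) && ~~ (S \subset ~: X)]].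

Record hs_instance : Type := HSInstance {
  hs_n : nat;
  hs_sets : seq (seq 'I_hs_n);
  hs_t : int
}.

Definition hitting_set (k : nat) : problem := {|
  instance := hs_instance;
  legal := fun I => sets_of_size_at_most k (family_of (hs_sets I));
  encode := fun I => node (enc_int (hs_t I)) (enc_family (hs_sets I));
  param := hs_n;
  answer := fun I => has_hitting_set (family_of (hs_sets I)) (hs_t I)
|}.

Record ss_instance : Type := SSInstance {
  ss_n : nat;
  ss_sets : seq (seq 'I_ss_n)
}.

Definition set_splitting (k : nat) : problem := {|
  instance := ss_instance;
  legal := fun I => sets_of_size_at_most k (family_of (ss_sets I));
  encode := fun I => enc_family (ss_sets I);
  param := ss_n;
  answer := fun I => has_splitting (family_of (ss_sets I))
|}.

(* Main.v *)
(* Idea.  Cut the universe of a Hitting Set instance into blocks of p elements and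
   guess, for a solution H, a bound d_i on the number of elements of H in each
   block, with sum at most t; there are at most (p+1)^(n/p+1) guesses, which is
   2^(eps n) up to a constant once p is large.  For a fixed guess the question is
   a Set Splitting instance on two more elements R and B, which {R, B} separates:
   on the side X of R, the sets S + {B} say that X hits every S, and the sets
   C + {R}, with C ranging over the (d_i+1)-subsets of the i-th block, say that X
   has at most d_i elements there.  All sets have size at most k+p+2.
   The Set Splitting algorithm is run O(n) times on each instance, and a majority
   vote brings the error below a third of the inverse of the number of guesses. *)
Require Import Defs.
From mathcomp Require Import all_boot all_order all_algebra.
From mathcomp Require Import all_classical all_reals all_analysis.
From mathcomp Require Import zify ring lra.
(* mathcomp-analysis has shadowed [eval]. *)
Import Defs.

Set Implicit Arguments.
Unset Strict Implicit.
Unset Printing Implicit Defensive.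

Import Order.TTheory GRing.Theory Num.Theory.

Local Open Scope ring_scope.

(** Time and error bounds have to be proved for a concrete program that calls an unknown algorithm
    [A] on variables of its own. Runs are therefore analysed with two credits, steps and error
    probability, handed from a command to its continuation; a random bit averages the error credits
    of its two outcomes. The constant 8/9 is (4/3)^2 / 2: among 2K votes, each wrong with
    probability at most 1/3, a wrong majority has probability at most (8/9)^K. With b blocks there
    are at most (p+1)^b guesses, so K = (b+1) C with (8/9)^C (p+1) <= 1/3 makes the union bound at
    most 1/3. Padding the universe to p b elements makes all blocks equal; together with R and B it
    raises the parameter by at most p + 2, which costs a constant factor in time. The block size p,
    and with it the set size k + p + 2, depends on eps: this is why limits in k are compared and not
    the exponents for a single k. The budget is min(t, n), because t is written in binary and may be
    exponential in the input size, whereas the program counts in unary. *)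

Fixpoint halts (T : nat) (c : config) : Prop :=
  if T is T'.+1 then halts T' (step c false) /\ halts T' (step c true)
  else halted c.

Lemma haltsP T c :
  (forall r : T.-tuple bool, halted (foldl step c r)) <-> halts T c.
Proof.
elim: T c => [|T IH] c /=.
  by split=> [/(_ [tuple])|h r] //; rewrite (tuple0 r).
split=> [h|[h0 h1] r].
  by split; apply/IH => r; [have := h [tuple of false :: r]|have := h [tuple of true :: r]].
case/tupleP: r => b r /=.
by case: b; [apply: (proj2 (IH _) h1)|apply: (proj2 (IH _) h0)].
Qed.

Lemma card_tuple_cons T (P : pred (seq bool)) :
  #|[set r : T.+1.-tuple bool | P r]| =
  (#|[set r : T.-tuple bool | P (false :: r)]| +
   #|[set r : T.-tuple bool | P (true :: r)]|)%N.
Proof.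
have inj b : injective (fun r : T.-tuple bool => [tuple of b :: r]).
  by move=> r r' /(congr1 val) [] /val_inj.
rewrite -(card_imset _ (inj false)) -(card_imset _ (inj true)) -cardsUI.
rewrite [X in (_ + X)%N]eq_card0 ?addn0; last first.
  move=> r; rewrite finset.in_setI; apply/andP => -[/imsetP[x _ ->] /imsetP[y _]].
  by move=> /(congr1 val).
apply: eq_card => r; rewrite finset.in_setU inE.
case/tupleP: r => b r.
apply/idP/orP => [Pr|[] /imsetP[x]]; last 2 first.
- by rewrite inE => Px ->.
- by rewrite inE => Px ->.
by case: b Pr => Pr; [right|left]; apply/imsetP; exists r; rewrite ?inE.
Qed.

(** * Joint accounting of running time and error probability *)

Section Safe.
Variables (R : realType) (wrong : store -> bool).

Fixpoint err (T : nat) (c : config) : R :=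
  if T is T'.+1 then (err T' (step c false) + err T' (step c true)) / 2
  else (wrong c.2)%:R.

Lemma err_count T c :
  #|[set r : T.-tuple bool | wrong (foldl step c r).2]|%:R / 2 ^+ T = err T c.
Proof.
elim: T c => [|T IH] c.
  rewrite expr0 divr1 /=; congr (_%:R).
  case: (boolP (wrong c.2)) => wc; last by apply: eq_card0 => r; rewrite inE (tuple0 r) (negbTE wc).
  rewrite (eq_card (B := predT)) => [|r]; last by rewrite inE (tuple0 r) wc.
  by rewrite card_tuple expn0.
rewrite (card_tuple_cons T (fun r => wrong (foldl step c r).2)) /= -!IH natrD exprS.
by rewrite -mulrDl -mulrA -invfM [2 ^+ T * 2]mulrC.
Qed.

(* T is a credit of steps and v a credit of error probability. *)
Definition safe (T : nat) (v : R) (c : config) : Prop :=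
  halts T c /\ err T c <= v.

Lemma step_halted c b : halted c -> step c b = c.
Proof. by case: c => -[]. Qed.

Lemma halts_err_halted T c : halted c -> halts T c /\ err T c = (wrong c.2)%:R.
Proof.
move=> hc; elim: T => //= T [hT eT].
by rewrite !step_halted //; split=> //; rewrite eT; lra.
Qed.

(** Halted configurations are fixed points of [step], so a run can be prolonged without changing its
    outcome. This is what lets every time bound be a mere upper bound. *)
Lemma halts_err_add d T c :
  halts T c -> halts (T + d) c /\ err (T + d) c = err T c.
Proof.
elim: T c => [c|T IH c [h0 h1]] /=; first exact: halts_err_halted.
by have [? ->] := IH _ h0; have [? ->] := IH _ h1.
Qed.

Lemma safe_weaken T T' v v' c :
  (T <= T')%N -> v <= v' -> safe T v c -> safe T' v' c.
Proof.
move=> leT lev [hT eT]; have [h e] := halts_err_add (T' - T) hT.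
by rewrite subnKC // in h e; split=> //; rewrite e (le_trans eT).
Qed.

Lemma safe_halted v c : halted c -> (wrong c.2)%:R <= v -> safe 0 v c.
Proof. by []. Qed.

Lemma safe_step T v c : (forall b, safe T v (step c b)) -> safe T.+1 v c.
Proof.
move=> h; have [h0 e0] := h false; have [h1 e1] := h true.
by split=> //=; lra.
Qed.

End Safe.

(** * Deterministic execution *)

Section Exec.
Variable R : realType.

(* In continuation-passing style, so that t is only an upper bound. *)
Definition exec (t : nat) (c : cmd) (s s' : store) : Prop :=
  forall wrong q T (v : R),
    safe wrong T v (q, s') -> safe wrong (t + T) v (c :: q, s).

Lemma exec_mono t t' c s s' : (t <= t')%N -> exec t c s s' -> exec t' c s s'.
Proof.
move=> le h w q T v /h; apply: safe_weaken => //.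
by rewrite leq_add2r.
Qed.

Lemma exec_assign x e s : exec 1 (Assign x e) s (update s x (eval s e)).
Proof. by move=> w q T v h; apply: safe_step. Qed.

Lemma exec_seq t1 t2 c1 c2 s s1 s2 :
  exec t1 c1 s s1 -> exec t2 c2 s1 s2 -> exec (t1 + t2).+1 (Seq c1 c2) s s2.
Proof.
move=> h1 h2 w q T v h; rewrite addSn -addnA; apply: safe_step => b /=.
by apply: h1; apply: h2.
Qed.

Lemma exec_if t e c1 c2 s s' :
  exec t (if is_leaf (eval s e) then c2 else c1) s s' ->
  exec t.+1 (If e c1 c2) s s'.
Proof. by move=> h w q T v hs; rewrite addSn; apply: safe_step => b /=; apply: h. Qed.

Lemma exec_while_stop e c s : is_leaf (eval s e) -> exec 1 (While e c) s s.
Proof. by move=> h w q T v hs; rewrite add1n; apply: safe_step => b /=; rewrite h. Qed.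

Lemma exec_while_step t t' e c s s1 s2 :
  ~~ is_leaf (eval s e) -> exec t c s s1 -> exec t' (While e c) s1 s2 ->
  exec (t + t').+1 (While e c) s s2.
Proof.
move=> h h1 h2 w q T v hs; rewrite addSn -addnA; apply: safe_step => b /=.
by rewrite (negbTE h); apply: h1; apply: h2.
Qed.

Lemma exec_loop t e c (I : nat -> store) n :
  (forall j, (j < n)%N -> ~~ is_leaf (eval (I j) e) /\ exec t c (I j) (I j.+1)) ->
  is_leaf (eval (I n) e) ->
  exec (n * t.+1).+1 (While e c) (I 0%N) (I n).
Proof.
move=> hI hn.
suff H m j : (j + m = n)%N -> exec (m * t.+1).+1 (While e c) (I j) (I n) by apply: H.
elim: m j => [|m IH] j; first by rewrite addn0 => ->; apply: exec_while_stop.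
move=> jm; have [h1 h2] := hI j ltac:(lia).
rewrite mulSn addSn -addnS; apply: exec_while_step h1 h2 _.
by apply: IH; lia.
Qed.

(** Meaningful for [straight] commands only; the value for [Toss] and [While] is a default. *)
Fixpoint den (c : cmd) (s : store) : store :=
  match c with
  | Assign x e => update s x (eval s e)
  | Seq c1 c2 => den c2 (den c1 s)
  | If e c1 c2 => if is_leaf (eval s e) then den c2 s else den c1 s
  | Toss _ | While _ _ => s
  end.

Fixpoint cost (c : cmd) : nat :=
  match c with
  | Seq c1 c2 => (cost c1 + cost c2).+1
  | If e c1 c2 => (cost c1 + cost c2).+1
  | _ => 1
  end.

Fixpoint straight (c : cmd) : bool :=
  match c with
  | Assign _ _ => true
  | Seq c1 c2 | If _ c1 c2 => straight c1 && straight c2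
  | Toss _ | While _ _ => false
  end.

Lemma exec_den c s : straight c -> exec (cost c) c s (den c s).
Proof.
elim: c s => //= [x e|c1 IH1 c2 IH2|e c1 IH1 c2 IH2] s.
- by move=> _; apply: exec_assign.
- by case/andP=> h1 h2; apply: exec_seq; [apply: IH1|apply: IH2].
- case/andP=> h1 h2; apply: exec_if; case: ifP => _.
    by apply: exec_mono (IH2 _ h2); rewrite leq_addl.
  by apply: exec_mono (IH1 _ h1); rewrite leq_addr.
Qed.

End Exec.

(** * Calling an algorithm as a subroutine *)

Fixpoint expr_below (M : nat) (e : expr) : bool :=
  match e with
  | Leaf => true
  | Var x => (x < M)%N
  | Node e1 e2 => expr_below M e1 && expr_below M e2
  | Left e1 | Right e1 => expr_below M e1
  end.

Fixpoint cmd_below (M : nat) (c : cmd) : bool :=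
  match c with
  | Assign x e => (x < M)%N && expr_below M e
  | Toss x => (x < M)%N
  | Seq c1 c2 => cmd_below M c1 && cmd_below M c2
  | If e c1 c2 => [&& expr_below M e, cmd_below M c1 & cmd_below M c2]
  | While e c1 => expr_below M e && cmd_below M c1
  end.

Lemma expr_belowW M N e : (M <= N)%N -> expr_below M e -> expr_below N e.
Proof.
move=> le; elim: e => //= [x|e1 IH1 e2 IH2 /andP[/IH1-> /IH2->]] //.
by move=> h; apply: leq_trans le.
Qed.

Lemma cmd_belowW M N c : (M <= N)%N -> cmd_below M c -> cmd_below N c.
Proof.
move=> le; elim: c => /= [x e|x|c1 IH1 c2 IH2|e c1 IH1 c2 IH2|e c IH].
- by case/andP=> h /(expr_belowW le)->; rewrite (leq_trans h).
- by move=> h; apply: leq_trans le.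
- by case/andP=> /IH1-> /IH2->.
- by case/and3P=> /(expr_belowW le)-> /IH1-> /IH2->.
- by case/andP=> /(expr_belowW le)-> /IH->.
Qed.

Lemma expr_below_ex e : exists M, expr_below M e.
Proof.
elim: e => [|x|e1 [M1 h1] e2 [M2 h2]|e1 [M1 h1]|e1 [M1 h1]].
- by exists 0%N.
- by exists x.+1 => /=.
- exists (maxn M1 M2) => /=.
  by rewrite (expr_belowW (leq_maxl _ _) h1) (expr_belowW (leq_maxr _ _) h2).
- by exists M1.
- by exists M1.
Qed.

(** The successor makes the bound positive, so that variable 0, which carries input and output,
    belongs to the subroutine. *)
Lemma cmd_below_ex c : exists M, cmd_below M.+1 c.
Proof.
elim: c => [x e|x|c1 [M1 h1] c2 [M2 h2]|e c1 [M1 h1] c2 [M2 h2]|e c [M1 h1]].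
- have [M he] := expr_below_ex e; exists (maxn x M) => /=.
  by rewrite ltnS leq_maxl (expr_belowW _ he) // ltnW // ltnS leq_maxr.
- by exists x => /=.
- exists (maxn M1 M2) => /=.
  by rewrite (cmd_belowW _ h1) ?(cmd_belowW _ h2) // ltnS ?leq_maxl ?leq_maxr.
- have [M he] := expr_below_ex e; exists (maxn M (maxn M1 M2)) => /=.
  by rewrite (expr_belowW _ he) ?(cmd_belowW _ h1) ?(cmd_belowW _ h2) //; lia.
- have [M he] := expr_below_ex e; exists (maxn M M1) => /=.
  by rewrite (expr_belowW _ he) ?(cmd_belowW _ h1) //; lia.
Qed.

(* The variables below M belong to the subroutine, the variable M + i holds the
   i-th entry of the list. *)
Definition st (M : nat) (s : store) (l : seq tree) : store :=
  fun y => if (y < M)%N then s y else nth leaf l (y - M).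

Lemma st_var M s l i : st M s l (M + i)%N = nth leaf l i.
Proof. by rewrite /st ltnNge leq_addr addKn. Qed.

Lemma st_low M s l i : (i < M)%N -> st M s l i = s i.
Proof. by rewrite /st => ->. Qed.

Lemma st_upd M s l i u :
  update (st M s l) (M + i) u = st M s (set_nth leaf l i u).
Proof.
apply: funext => y; rewrite /update /st.
case: ltnP => hy; first by rewrite ifN //; lia.
rewrite nth_set_nth /= -(subnK hy) addnK addnC.
by rewrite eqn_add2l.
Qed.

Ltac run := repeat (rewrite /=; first [rewrite st_upd | rewrite st_var]); rewrite /=.

Lemma st_upd_low M s l i u :
  (i < M)%N -> update (st M s l) i u = st M (update s i u) l.
Proof.
move=> hi; apply: funext => y; rewrite /update /st.
by case: eqP => [->|//]; rewrite hi.
Qed.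

Lemma eq_st M s s' l : (forall y, (y < M)%N -> s y = s' y) -> st M s l = st M s' l.
Proof. by move=> h; apply: funext => y; rewrite /st; case: ifP => // /h. Qed.

Lemma eval_st M s l e : expr_below M e -> eval (st M s l) e = eval s e.
Proof.
elim: e => //= [x|e1 IH1 e2 IH2|e IH|e IH].
- exact: st_low.
- by case/andP=> /IH1-> /IH2->.
- by move=> /IH->.
- by move=> /IH->.
Qed.

(** A command below [M] neither reads nor writes the variables of the caller, so it moves in
    lockstep with an isolated copy of itself, whatever [q] and [l] are. *)
Lemma step_st M qa sa q l b :
  all (cmd_below M) qa -> ~~ nilp qa ->
  let: (qa', sa') := step (qa, sa) b in
  all (cmd_below M) qa' /\
  step (qa ++ q, st M sa l) b = (qa' ++ q, st M sa' l).
Proof.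
case: qa => //= c qa /andP[hc ha] _.
case: c hc => [x e|x|c1 c2|e c1 c2|e c] /=.
- by case/andP=> hx he; split=> //; rewrite eval_st // st_upd_low.
- by move=> hx; split=> //; rewrite st_upd_low.
- by case/andP=> -> ->.
- case/and3P=> he h1 h2; rewrite eval_st //.
  by case: ifP => _; rewrite /= ?h1 ?h2.
- case/andP=> he h1; rewrite eval_st //.
  by case: ifP => _; rewrite /= ?h1 ?he.
Qed.

(** The error credit is the expectation of what the continuation demands: [v1] if the subroutine
    ends in a [bad] store, [v0] otherwise. The store [sa'] is arbitrary because nothing is known
    about what the subroutine leaves behind. *)
Lemma safe_sub (R : realType) (wrong bad : store -> bool) M T T' (v0 v1 : R)
    qa sa q l :
  all (cmd_below M) qa -> halts T (qa, sa) ->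
  (forall sa', safe wrong T' (if bad sa' then v1 else v0) (q, st M sa' l)) ->
  safe wrong (T + T') (v0 + (v1 - v0) * err R bad T (qa, sa)) (qa ++ q, st M sa l).
Proof.
move=> + + h; elim: T qa sa => [|T IH] qa sa ha /=.
  move=> /nilP/= ->; rewrite add0n /=; move: (h sa); apply: safe_weaken => //.
  by case: (bad sa) => /=; lra.
move=> [h0 h1].
(* The subroutine may finish before its credit is spent; the continuation then starts at once. *)
have [/nilP ->|qa0] := boolP (nilp qa).
  have [_ e] := halts_err_halted R bad T (c := ([::], sa)) isT.
  move: (h sa); apply: safe_weaken; first exact: leq_addl.
  by rewrite e /=; case: (bad sa) => /=; lra.
have hb b : halts T (step (qa, sa) b) ->
    safe wrong (T + T') (v0 + (v1 - v0) * err R bad T (step (qa, sa) b))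
      (step (qa ++ q, st M sa l) b).
  move: (step_st sa q l b ha qa0); case: (step (qa, sa) b) => qa' sa' [ha' ->].
  exact: IH.
have [H0 E0] := hb false h0; have [H1 E1] := hb true h1.
by rewrite addSn; split => /=; [|lra].
Qed.

Lemma safe_sub_third (R : realType) (wrong bad : store -> bool) M T T' (v0 v1 : R)
    qa sa q l :
  all (cmd_below M) qa -> halts T (qa, sa) -> err R bad T (qa, sa) <= 1 / 3 ->
  v0 <= v1 ->
  (forall sa', safe wrong T' (if bad sa' then v1 else v0) (q, st M sa' l)) ->
  safe wrong (T + T') (2 / 3 * v0 + 1 / 3 * v1) (qa ++ q, st M sa l).
Proof.
move=> ha hT he le h; have := safe_sub ha hT h.
by apply: safe_weaken => //; nra.
Qed.

Definition skip (x : nat) : cmd := Assign x (Var x).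

(** The guarantees on an algorithm assume that its work variables start as [leaf], so they are
    cleared before each call. *)
Fixpoint reset (M : nat) : cmd :=
  if M is M'.+1 then Seq (reset M') (Assign M' Leaf) else skip 0.

Lemma update_id s x : update s x (s x) = s.
Proof. by apply: funext => y; rewrite /update; case: eqP => [->|]. Qed.

Lemma exec_reset (R : realType) M s l :
  exec R M.*2.+1 (reset M) (st M s l) (st M (fun=> leaf) l).
Proof.
suff H N : (N <= M)%N ->
    exec R N.*2.+1 (reset N) (st M s l) (st M (fun y => if (y < N)%N then leaf else s y) l).
  rewrite [X in exec _ _ _ _ X](_ : _ = st M (fun y => if (y < M)%N then leaf else s y) l); first exact: H.
  by apply: eq_st => y ->.
elim: N => [_|N IH leN] /=.
  rewrite -[X in exec _ _ _ _ X](update_id _ 0); exact: exec_assign.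
rewrite doubleS -addn1; apply: exec_seq (IH (ltnW leN)) _.
rewrite [X in exec _ _ _ _ X](_ : _ = update (st M (fun y => if (y < N)%N then leaf else s y) l) N (eval s Leaf)).
  exact: exec_assign.
rewrite st_upd_low //; apply: eq_st => y yM; rewrite /update ltnS leq_eqVlt.
by case: eqP.
Qed.

(** * The reduction *)

Section Reduction.
Local Open Scope nat_scope.

Fixpoint combs (T : Type) (k : nat) (s : seq T) : seq (seq T) :=
  if k is k'.+1 then
    if s is x :: s' then map (cons x) (combs k' s') ++ combs k s' else [::]
  else [:: [::]].

Lemma map_combs (T U : Type) (f : T -> U) k s :
  map (map f) (combs k s) = combs k (map f s).
Proof.
elim: s k => [|x s IH] [|k] //=.
by rewrite map_cat -!IH -!map_comp.
Qed.

Lemma has_all_combs (T : Type) (X : pred T) k s :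
  has (all X) (combs k s) = (k <= count X s).
Proof.
elim: s k => [|x s IH] [|k] //=; rewrite has_cat has_map IH.
case: (boolP (X x)) => Xx /=.
  rewrite (eq_has (a2 := all X)) => [|c /=]; last by rewrite Xx.
  by rewrite IH; lia.
rewrite (eq_has (a2 := xpred0)) => [|c /=]; last by rewrite (negbTE Xx).
by rewrite has_pred0.
Qed.

Lemma size_combs (T : Type) k (s : seq T) : size (combs k s) <= 2 ^ size s.
Proof.
elim: s k => [|x s IH] [|k] //=; first by rewrite expn_gt0.
by rewrite size_cat size_map expnS mul2n -addnn leq_add.
Qed.

Lemma combsP (T : eqType) k (s c : seq T) :
  c \in combs k s -> size c = k /\ {subset c <= s}.
Proof.
elim: s k c => [|x s IH] [|k] c //=.
- by rewrite inE => /eqP ->.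
- by rewrite inE => /eqP ->.
rewrite mem_cat => /orP[/mapP[c' /IH[<- sub] ->]|/IH[<- sub]].
  by split=> // y; rewrite !inE => /orP[->//|/sub->]; rewrite orbT.
by split=> // y /sub ys; rewrite inE ys orbT.
Qed.

Definition splits (X : pred nat) (L : seq (seq nat)) : bool :=
  all (fun s => has X s && has (predC X) s) L.

Lemma has_flatten (T : Type) (a : pred T) ss : has a (flatten ss) = has (has a) ss.
Proof. by elim: ss => //= s ss IH; rewrite has_cat IH. Qed.

Variables (p R : nat).

(** Listed downwards from [r], because the program holds [r] in unary and obtains [r - j] by taking
    the right subtree j times. *)
Definition block (r : nat) : seq nat := [seq r - j | j <- iota 1 p].

(* At most d elements of the block below r lie on the side of R. *)
Definition at_most (d r : nat) : seq (seq nat) :=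
  [seq R :: c | c <- combs d.+1 (block r)].

(* u bounds the sum of the remaining guesses. *)
Fixpoint guesses (b u : nat) (L : seq (seq nat)) : seq (seq (seq nat)) :=
  if b is b'.+1 then
    flatten [seq if d <= u then guesses b' (u - d) (at_most d (p * b) ++ L)
                 else [::] | d <- iota 0 p.+1]
  else [:: L].

Lemma guessesS b u L :
  guesses b.+1 u L =
  flatten [seq if d <= u then guesses b (u - d) (at_most d (p * b.+1) ++ L)
               else [::] | d <- iota 0 p.+1].
Proof. by []. Qed.

Lemma count_block X b :
  count X (iota 0 (p * b.+1)) = count X (iota 0 (p * b)) + count X (block (p * b.+1)).
Proof.
rewrite mulnS addnC iotaD count_cat add0n; congr (_ + _).
apply/permP; apply: uniq_perm; first exact: iota_uniq.
  rewrite map_inj_in_uniq ?iota_uniq // => i j; rewrite !mem_iota; lia.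
move=> x; rewrite mem_iota; apply/idP/mapP => [h|[j]].
  exists (p * b + p - x); last by lia.
  by rewrite mem_iota; lia.
by rewrite mem_iota; lia.
Qed.

Lemma splits_at_most (X : pred nat) d r :
  X R -> splits X (at_most d r) = (count X (block r) <= d).
Proof.
move=> XR; rewrite /splits /at_most all_map leqNgt -has_all_combs -all_predC.
by apply: eq_all => c /=; rewrite XR /= has_predC.
Qed.

(** For a fixed [X] the best guess is the exact number of elements of [X] in each block: a smaller
    bound is violated, a larger one only wastes budget. *)
Lemma has_splits_guesses (X : pred nat) b u L : X R ->
  has (splits X) (guesses b u L) = splits X L && (count X (iota 0 (p * b)) <= u).
Proof.
move=> XR; elim: b u L => [|b IH] u L; first by rewrite /= muln0 /= !orbF andbT.
rewrite guessesS has_flatten has_map.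
set c := count X (block (p * b.+1)).
have cp : c <= p by rewrite (leq_trans (count_size _ _)) // size_map size_iota.
rewrite (eq_has (a2 := fun d => [&& d <= u, c <= d, splits X L &
    count X (iota 0 (p * b)) <= u - d])) => [|d]; last first.
  rewrite /preim /=; case: ifP => //= _.
  by rewrite IH /splits all_cat -/(splits _ _) -/(splits _ _) splits_at_most // andbA.
rewrite count_block -/c.
apply/hasP/andP => [[d _ /and4P[h1 h2 -> h3]]|[h1 h2]]; first by split=> //; lia.
exists c; first by rewrite mem_iota; lia.
by rewrite h1 leqnn /=; lia.
Qed.

Lemma size_guesses b u L : size (guesses b u L) <= p.+1 ^ b.
Proof.
elim: b u L => [//|b IH] u L.
rewrite guessesS size_flatten /shape -map_comp sumnE big_map expnS.
apply: (leq_trans (n := \sum_(d <- iota 0 p.+1) p.+1 ^ b)).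
  by apply: leq_sum => d _ /=; case: ifP.
by rewrite big_const_seq count_predT size_iota iter_addn_0 mulnC.
Qed.

(** An invariant indexed by the number of blocks still to be guessed; it serves for the range of the
    elements, the sizes of the sets and their number. *)
Lemma guesses_ind (P : nat -> seq (seq nat) -> Prop) :
  (forall b d L, d <= p -> P b.+1 L -> P b (at_most d (p * b.+1) ++ L)) ->
  forall b u L, P b L -> forall L', L' \in guesses b u L -> P 0 L'.
Proof.
move=> HP; elim=> [|b IH] u L PL L'; first by rewrite inE => /eqP ->.
rewrite guessesS => /flattenP[_ /mapP[d + ->]].
rewrite mem_iota => dp; case: ifP => // _; apply: IH; apply: HP => //; lia.
Qed.

End Reduction.

(** * Hitting sets versus splittings of the guessed instances *)

Section Equivalence.
Local Open Scope nat_scope.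

(** Written with an accumulator so that one pass of the loop in [base_prog] is one step of the
    fold. *)
Definition base_sets (a : nat) (L : seq (seq nat)) : seq (seq nat) :=
  foldl (fun acc s => (a.+1 :: s) :: acc) [:: [:: a; a.+1]] L.

Lemma all_base_sets (P : pred (seq nat)) a L :
  all P (base_sets a L) = P [:: a; a.+1] && all (fun s => P (a.+1 :: s)) L.
Proof.
rewrite /base_sets -[P [:: a; _]]andbT -[_ && true]/(all P [:: _]).
elim: L [:: _] => [|s L IH] acc /=; first by rewrite andbT.
by rewrite IH /= -andbA andbCA.
Qed.

Definition hs_nat (I : hs_instance) : seq (seq nat) :=
  [seq [seq nat_of_ord x | x <- s] | s <- hs_sets I].

Lemma count_iota_ord (X : pred nat) n :
  count X (iota 0 n) = #|[set y : 'I_n | X (nat_of_ord y)]|.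
Proof.
rewrite -val_enum_ord count_map cardE -size_filter; congr size.
rewrite {2}/enum_mem -enumT; apply: eq_filter => y.
by rewrite /= inE.
Qed.

Lemma hs_natP (I : hs_instance) :
  has_hitting_set (family_of (hs_sets I)) (hs_t I) <->
  exists X : pred nat, ((count X (iota 0 (hs_n I)))%:Z <= hs_t I)%R /\
    all (has X) (hs_nat I).
Proof.
case: I => n L t; rewrite /hs_nat /=; split.
  case/existsP => H /andP[cH /forallP hH].
  exists (fun x => [exists y in H, nat_of_ord y == x]); split.
    apply: le_trans cH; rewrite lez_nat count_iota_ord; apply/subset_leq_card/fintype.subsetP.
    by move=> y; rewrite inE => /existsP[z /andP[zH /eqP/val_inj <-]].
  apply/allP => _ /mapP[s sL ->].
  have := hH [set x in s]; rewrite inE map_f // => /finset.set0Pn[y].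
  rewrite !inE => /andP[yH ys]; apply/hasP; exists (nat_of_ord y); first exact: map_f.
  by apply/existsP; exists y; rewrite yH eqxx.
case=> X [cX /allP hX]; apply/existsP; exists [set y | X (nat_of_ord y)].
apply/andP; split.
  by rewrite -count_iota_ord.
apply/forallP => S; apply/implyP; rewrite inE => /mapP[s sL ->].
have /hasP[_ /mapP[y ys ->] Xy] := hX [seq nat_of_ord x | x <- s] (map_f _ sL).
by apply/finset.set0Pn; exists y; rewrite !inE Xy.
Qed.

(** [inord] sends an element out of range to 0, so correctness and encoding are stated for lists
    with entries below [a.+2]. *)
Definition ss_of (a : nat) (L : seq (seq nat)) : ss_instance :=
  {| ss_n := a.+2; ss_sets := [seq [seq inord x | x <- s] | s <- L] |}.

Lemma ss_ofP a L : all (all (fun x => x < a.+2)) L ->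
  has_splitting (family_of (ss_sets (ss_of a L))) <-> exists X, splits X L.
Proof.
move=> /allP hL; rewrite /ss_of /=; split.
  case/existsP => X /forallP hX; exists (fun x => inord x \in X).
  apply/allP => s sL; have := hX [set x in [seq inord x | x <- s]].
  rewrite inE (map_f (fun s : seq 'I_a.+2 => [set x in s])) ?map_f //=.
  case/andP => /fintype.subsetPn[y]; rewrite inE => /mapP[x xs ->] nX.
  case/fintype.subsetPn=> y'; rewrite inE => /mapP[x' xs' ->]; rewrite inE negbK => X'.
  by apply/andP; split; apply/hasP; [exists x'|exists x].
case=> X /allP hX; apply/existsP; exists [set y | X (nat_of_ord y)].
apply/forallP => S; apply/implyP; rewrite inE => /mapP[_ /mapP[s sL ->] ->].
have /allP hs := hL _ sL.
have /andP[/hasP[x xs Xx] /hasP[y ys Xy]] := hX _ sL.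
apply/andP; split; apply/fintype.subsetPn.
  by exists (inord y); rewrite inE ?map_f // inordK ?hs.
by exists (inord x); rewrite !inE ?map_f // negbK inordK ?hs.
Qed.

Lemma splitsC (X : pred nat) L : splits X L -> splits (predC X) L.
Proof.
move=> /allP h; apply/allP => s /h /andP[h1 h2]; rewrite h2 /=.
by rewrite (eq_has (a2 := X)) // => x /=; rewrite negbK.
Qed.

Lemma splits_base (X : pred nat) a L : X a ->
  splits X (base_sets a L) =
  ~~ X a.+1 && all (has X) L.
Proof.
move=> Xa; rewrite /splits all_base_sets /= Xa /=.
case: (boolP (X a.+1)) => //= Xa1.
by apply: eq_all => s; rewrite andbT.
Qed.

Definition hs_guesses (p b : nat) (I : hs_instance) : seq (seq (seq nat)) :=
  guesses p (p * b) b (minn `|hs_t I|%N (hs_n I))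
    (base_sets (p * b) (hs_nat I)).

Lemma hs_nat_lt I : all (all (fun x => x < hs_n I)) (hs_nat I).
Proof.
by apply/allP => _ /mapP[s _ ->]; apply/allP => _ /mapP[x _ ->].
Qed.

Lemma guesses_lt p b (I : hs_instance) L : hs_n I <= p * b ->
  L \in hs_guesses p b I -> all (all (fun x => x < (p * b).+2)) L.
Proof.
move=> nb LI; apply: (proj2 (guesses_ind (p := p) (R := p * b)
  (P := fun b' L => b' <= b /\ all (all (fun x => x < (p * b).+2)) L) _ _ LI)).
- move=> b' d L' _ [b'b IH]; split; first exact: ltnW.
  rewrite all_cat IH andbT.
  apply/allP => _ /mapP[c /combsP[_ sub] ->] /=; apply/andP; split; first lia.
  apply/allP => x /sub /mapP[j _ ->].
  by have := leq_mul2l p b'.+1 b; lia.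
- split=> //; rewrite all_base_sets /= !ltnS leqnn ltnW //=.
  apply/allP => s sI /=.
  have /allP hs := allP (hs_nat_lt I) _ sI.
  by apply/allP => x /hs; lia.
Qed.

Lemma card_set_seq (T : finType) (s : seq T) : #|[set x in s]| = size (undup s).
Proof.
rewrite -(card_uniqP (undup_uniq s)); apply: eq_card => x.
by rewrite inE mem_undup.
Qed.

Lemma size_undup_map (T U : eqType) (f : T -> U) (s : seq T) :
  size (undup (map f s)) <= size (undup s).
Proof.
rewrite -(size_map f); apply: uniq_leq_size; first exact: undup_uniq.
by move=> y; rewrite mem_undup => /mapP[x xs ->]; rewrite map_f // mem_undup.
Qed.

Lemma size_undup_cons (T : eqType) (x : T) s : size (undup (x :: s)) <= (size (undup s)).+1.
Proof. by rewrite /=; case: ifP. Qed.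

(** The set {R, B} has 2 elements, the sets S + {B} at most k + 1, the sets C + {R} at most p + 2.
    Sizes are taken after [undup] because input lists may repeat elements. *)
Lemma guesses_legal k p b (I : hs_instance) L :
  sets_of_size_at_most k (family_of (hs_sets I)) -> L \in hs_guesses p b I ->
  sets_of_size_at_most (k + p + 2) (family_of (ss_sets (ss_of (p * b) L))).
Proof.
move=> hI LI.
suff /allP h : all (fun s : seq nat => size (undup s) <= k + p + 2) L.
  apply/forallP => S; apply/implyP; rewrite inE => /mapP[_ /mapP[s sL ->] ->].
  by rewrite card_set_seq (leq_trans (size_undup_map _ _)) ?h.
apply: (guesses_ind (p := p) (R := p * b)
  (P := fun b' L => all (fun s : seq nat => size (undup s) <= k + p + 2) L)) LI => //.
- move=> b' d L' dp IH; rewrite all_cat IH ?andbT.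
  apply/allP => _ /mapP[c /combsP[sc _] ->]; rewrite (leq_trans (size_undup _)) //=; rewrite sc; lia.
- rewrite all_base_sets (leq_trans (size_undup _)) /=; last lia.
  apply/allP => _ /mapP[s sI ->]; rewrite (leq_trans (size_undup_cons _ _)) //.
  rewrite addn2 ltnS (leq_trans (size_undup_map _ _)) //.
  have /forallP/(_ [set x in s])/implyP := hI; rewrite card_set_seq => h.
  by rewrite (leq_trans (h _)) ?leqW ?leq_addr // inE map_f.
Qed.

Lemma guessesP p b (I : hs_instance) : (0 <= hs_t I)%R -> hs_n I <= p * b ->
  has_hitting_set (family_of (hs_sets I)) (hs_t I) =
  has (fun L => has_splitting (family_of (ss_sets (ss_of (p * b) L))))
    (hs_guesses p b I).
Proof.
move=> t0 nb; have hsplit := guesses_lt nb.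
have le_t c : (c%:Z <= hs_t I)%R = (c <= `|hs_t I|) by rewrite -lez_nat gez0_abs.
have hiota Y : count Y (iota 0 (hs_n I)) <= hs_n I.
  by rewrite (leq_trans (count_size _ _)) ?size_iota.
apply/idP/hasP => [/hs_natP[X [cX /allP hX]]|[L LI /ss_ofP]].
  (* [Y] drops the padding, where [X] is unconstrained, takes R in and leaves B out. *)
  pose Y x := (x < hs_n I) && X x || (x == p * b).
  have YR : Y (p * b) by rewrite /Y eqxx orbT.
  have : has (splits Y) (hs_guesses p b I).
    rewrite has_splits_guesses // splits_base //; apply/andP; split.
      apply/andP; split; first by rewrite /Y; lia.
      apply/allP => s sI; have /hasP[x xs Xx] := hX s sI.
      apply/hasP; exists x => //.
      by rewrite /Y Xx (allP (allP (hs_nat_lt I) _ sI)).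
    rewrite (eq_in_count (a2 := fun x => (x < hs_n I) && X x)); last first.
      by move=> x; rewrite mem_iota /Y => h; rewrite [x == _]ltn_eqF ?orbF; lia.
    rewrite -(subnKC nb) iotaD count_cat add0n.
    rewrite (eq_in_count (a2 := X)); last first.
      by move=> x; rewrite mem_iota => /= ->.
    rewrite [X in _ + X](eq_in_count (a2 := pred0)) ?count_pred0 ?addn0.
      by rewrite leq_min hiota -le_t cX.
    by move=> x; rewrite mem_iota => h; apply/negbTE; lia.
  case/hasP => L LI sL; exists L => //.
  by apply/ss_ofP; [apply: hsplit|exists Y].
case; first exact: hsplit.
move=> X0 sX0.
(* The complement of a splitting splits too, so R may be assumed to lie on side [X]. *)
have [X XR sX] : exists2 X : pred nat, X (p * b) & splits X L.
  case: (boolP (X0 (p * b))) => h; first by exists X0.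
  by exists (predC X0) => //; apply: splitsC.
have : has (splits X) (hs_guesses p b I) by apply/hasP; exists L.
rewrite has_splits_guesses // splits_base // => /andP[/andP[_ hX] cX].
apply/hs_natP; exists X; split=> //; rewrite le_t.
move: cX; rewrite -(subnKC nb) iotaD count_cat leq_min; lia.
Qed.

End Equivalence.

(** * The program *)

Definition enc_sets (L : seq (seq nat)) : tree :=
  enc_seq [seq enc_seq [seq enc_unary x | x <- s] | s <- L].

Lemma enc_unaryS n : enc_unary n.+1 = node leaf (enc_unary n).
Proof. by []. Qed.

Lemma right_of_unary n : right_of (enc_unary n) = enc_unary n.-1.
Proof. by case: n. Qed.

Lemma is_leaf_unary n : is_leaf (enc_unary n) = (n == 0)%N.
Proof. by case: n. Qed.

(** The subtraction is truncated on both sides, since [right_of leaf] is [leaf]. *)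
Lemma eval_iter_Right s k e n :
  eval s e = enc_unary n -> eval s (iter k Right e) = enc_unary (n - k).
Proof.
move=> h; elim: k => [|k IH] /=; first by rewrite subn0.
by rewrite IH right_of_unary -subn1 -subnDA addn1.
Qed.

Lemma eval_iter_Node s k e n :
  eval s e = enc_unary n -> eval s (iter k (Node Leaf) e) = enc_unary (k + n).
Proof. by move=> h; elim: k => [|k IH] //=; rewrite IH. Qed.

Lemma enc_seq_foldr us : enc_seq us = foldr node leaf us.
Proof. by elim: us => //= u us ->. Qed.

Definition cons_sets (L : seq (seq expr)) (e : expr) : expr :=
  foldr Node e [seq foldr Node Leaf s | s <- L].

Lemma eval_foldr_Node s es e us :
  map (eval s) es = us -> eval s (foldr Node e es) = foldr node (eval s e) us.
Proof. by move=> <-; elim: es => //= e1 es ->. Qed.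

Lemma eval_cons_sets s Le L0 e L :
  map (map (eval s)) Le = map (map enc_unary) L0 ->
  eval s e = enc_sets L ->
  eval s (cons_sets Le e) = enc_sets (L0 ++ L).
Proof.
move=> h he; rewrite [RHS]enc_seq_foldr map_cat foldr_cat -enc_seq_foldr -/(enc_sets L) -he.
apply: eval_foldr_Node; elim: Le L0 h => [|l Le IH] [|l0 L0] //= [h1 /IH ->].
by rewrite enc_seq_foldr (eval_foldr_Node _ (us := map enc_unary l0)).
Qed.

Section Loops.
Variable R : realType.

Lemma exec_foldl (X Y : Type) (Inv : Y -> Prop) t e c (f : Y -> X -> Y)
    (I : seq X -> Y -> store) :
  (forall x s y, Inv y ->
    [/\ ~~ is_leaf (eval (I (x :: s) y) e), Inv (f y x)
      & exec R t c (I (x :: s) y) (I s (f y x))]) ->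
  (forall y, is_leaf (eval (I [::] y) e)) ->
  forall s y, Inv y ->
    exec R (size s * t.+1).+1 (While e c) (I s y) (I [::] (foldl f y s)).
Proof.
move=> hI h0; elim=> [|x s IH] y hy; first exact: exec_while_stop.
have [h1 h2 h3] := hI x s y hy.
rewrite [size _]/= mulSn addSn -addnS.
by apply: exec_while_step h1 h3 _; apply: IH.
Qed.

End Loops.

(* Variables, counted from M: 0 scratch; 1 the size a = p * b of the padded
   universe, which is also the element R, while B is a + 1; 2 the bound u on the
   sum of the guesses; 3 the rest n - u; 4 the reversed bits of t; 5 the sets
   common to all guesses; 6 the stack of the depth-first search; 7 the list of
   the instances produced; 8 and 9 the number of votes 2 K and the majority K;
   10 the votes to come; 11 the positive votes missing for a majority; 12 the
   answer; 13 the input. *)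
Section Program.
Variables (M p C : nat) (A : cmd).

Let V i := Var (M + i).
Let W i e := Assign (M + i) e.
Let nop := skip M.

(** The numbers of votes grow along with the blocks, which avoids a multiplication; [pad_prog]
    starts them at [C.*2] and [C], whence K = (b+1) C. *)
Definition pad_body : cmd :=
  Seq (W 0 (iter p Right (V 0)))
  (Seq (W 1 (iter p (Node Leaf) (V 1)))
  (Seq (W 8 (iter C.*2 (Node Leaf) (V 8)))
       (W 9 (iter C (Node Leaf) (V 9))))).

Definition pad_prog : cmd :=
  Seq (Seq (W 0 (Left (Right (V 13))))
      (Seq (W 8 (iter C.*2 (Node Leaf) Leaf))
           (W 9 (iter C (Node Leaf) Leaf))))
      (While (V 0) pad_body).

Definition base_prog : cmd :=
  Seq (Seq (W 5 (Node (Node (V 1) (Node (Node Leaf (V 1)) Leaf)) Leaf))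
           (W 0 (Right (Right (V 13)))))
      (While (V 0)
        (Seq (W 5 (Node (Node (Node Leaf (V 1)) (Left (V 0))) (V 5)))
             (W 0 (Right (V 0))))).

(** The bits of t come least significant first, while the Horner scheme of [min_prog] consumes the
    most significant one first. *)
Definition rev_prog : cmd :=
  Seq (W 0 (Right (Left (V 13))))
      (While (V 0)
        (Seq (W 4 (Node (Left (V 0)) (V 4)))
             (W 0 (Right (V 0))))).

(** Addition saturating at n: variable 3 is the room left, and once it is empty variable 2 stops
    growing. *)
Definition add_body : cmd :=
  Seq (If (V 3) (Seq (W 2 (Node Leaf (V 2))) (W 3 (Right (V 3)))) nop)
      (W 0 (Right (V 0))).

Definition min_body : cmd :=
  Seq (Seq (W 0 (V 2)) (If (Left (V 4)) (W 0 (Node Leaf (V 0))) nop))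
  (Seq (While (V 0) add_body)
       (W 4 (Right (V 4)))).

Definition min_prog : cmd :=
  Seq (W 3 (Left (Right (V 13)))) (While (V 4) min_body).

(* The current state is in variable 0: the part of the universe not yet
   treated, the remaining budget, and the sets produced so far. *)
Definition guess_exprs (d : nat) : seq (seq expr) :=
  [seq V 1 :: c | c <- combs d.+1 [seq iter j Right (Left (V 0)) | j <- iota 1 p]].

(** As [p] and [d] are fixed in the program text, all the subsets are spelled out as expressions,
    and a whole state is built by one assignment, that is in one step. *)
Definition child (d : nat) : expr :=
  Node (iter p Right (Left (V 0)))
    (Node (iter d Right (Left (Right (V 0))))
      (cons_sets (guess_exprs d) (Right (Right (V 0))))).

(** The additional [Leaf] turns the test into u + 1 - d <> 0, that is d <= u. *)
Definition push (d : nat) : cmd :=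
  If (iter d Right (Node Leaf (Left (Right (V 0)))))
     (W 6 (Node (child d) (V 6))) nop.

Definition pushes (ds : seq nat) : cmd := foldr (fun d c => Seq (push d) c) nop ds.

Definition dfs_body : cmd :=
  Seq (Seq (W 0 (Left (V 6))) (W 6 (Right (V 6))))
    (If (Left (V 0)) (pushes (iota 0 p.+1))
        (W 7 (Node (Right (Right (V 0))) (V 7)))).

Definition vote_body : cmd :=
  Seq (Seq (reset M)
           (Assign 0 (Node (Node Leaf (Node Leaf (V 1))) (Left (V 7)))))
  (Seq A
       (Seq (If (Var 0) (W 11 (Right (V 11))) nop)
            (W 10 (Right (V 10))))).

Definition test_body : cmd :=
  Seq (Seq (W 10 (V 8)) (W 11 (V 9)))
  (Seq (While (V 10) vote_body)
       (Seq (If (V 11) nop (W 12 (Node Leaf Leaf)))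
            (W 7 (Right (V 7))))).

Definition main_prog : cmd :=
  Seq (Seq pad_prog (Seq base_prog (Seq rev_prog min_prog)))
  (Seq (W 6 (Node (Node (V 1) (Node (V 2) (V 5))) Leaf))
  (Seq (While (V 6) dfs_body)
  (Seq (While (V 7) test_body)
       (Assign 0 (V 12))))).

Definition hs_prog : cmd :=
  Seq (W 13 (Var 0))
      (If (Left (Left (V 13))) (Assign 0 Leaf) main_prog).

(** * Effect and cost of each deterministic phase *)

Section Phases.
Variable R : realType.
Local Open Scope nat_scope.

Lemma exec_straight c s s' t :
  straight c -> den c s = s' -> cost c <= t -> exec R t c s s'.
Proof. by move=> h <- ct; apply: exec_mono ct _; apply: exec_den. Qed.

Lemma exec_prefix c1 c2 s s1 s2 t t2 :
  straight c1 -> den c1 s = s1 -> exec R t2 c2 s1 s2 -> cost c1 + t2 < t ->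
  exec R t (Seq c1 c2) s s2.
Proof.
move=> h1 <- h2 ht; apply: exec_mono ht _; apply: exec_seq h2.
exact: exec_den.
Qed.

Lemma exec_suffix c1 c2 s s1 s2 t t1 :
  exec R t1 c1 s s1 -> straight c2 -> den c2 s1 = s2 -> t1 + cost c2 < t ->
  exec R t (Seq c1 c2) s s2.
Proof.
move=> h1 h2 <- ht; apply: exec_mono ht _; apply: exec_seq h1 _.
exact: exec_den.
Qed.

Lemma exec_pad s w x2 x3 x4 x5 x6 x7 x8 x9 x10 x11 x12 t L n b :
  0 < p -> b = (n + p.-1) %/ p ->
  exec R (b * 8 + 7) pad_prog
    (st M s [:: w; leaf; x2; x3; x4; x5; x6; x7; x8; x9; x10; x11; x12; node t (node (enc_unary n) L)])
    (st M s [:: leaf; enc_unary (p * b); x2; x3; x4; x5; x6; x7;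
       enc_unary (b.+1 * C.*2); enc_unary (b.+1 * C); x10; x11; x12; node t (node (enc_unary n) L)]).
Proof.
move=> p0 bE.
(* As [b] is the ceiling of n / p, the loop test n - p j <> 0 succeeds exactly for j < b. *)
have lt_b j : (j < b) = (p * j < n).
  by rewrite bE leq_divRL // mulSn mulnC; lia.
pose I j := st M s [:: enc_unary (n - p * j); enc_unary (p * j); x2; x3; x4; x5; x6; x7;
       enc_unary (j.+1 * C.*2); enc_unary (j.+1 * C); x10; x11; x12; node t (node (enc_unary n) L)].
have hI : exec R (b * 8).+1 (While (V 0) pad_body) (I 0) (I b).
  apply: exec_loop => [j|]; last first.
    by rewrite /I; run; rewrite is_leaf_unary subn_eq0 leqNgt -lt_b ltnn.
  rewrite lt_b => jb; split; first by rewrite /I; run; rewrite is_leaf_unary; lia.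
  apply: exec_straight => //; rewrite /I.
  run; rewrite !(@eval_iter_Right _ p _ (n - p * j)); last by run.
  rewrite (@eval_iter_Node _ p _ (p * j)); last by run.
  rewrite (@eval_iter_Node _ C.*2 _ (j.+1 * C.*2)); last by run.
  rewrite (@eval_iter_Node _ C _ (j.+1 * C)); last by run.
  by rewrite -subnDA -!mulSn addnC -mulnS.
have IbE : n - p * b = 0 by apply/eqP; rewrite subn_eq0 leqNgt -lt_b ltnn.
rewrite {2}/I IbE in hI.
refine (@exec_prefix _ _ _ (I 0) _ _ _ _ _ hI _); rewrite //=.
  run; rewrite /I muln0 subn0 !mul1n.
  rewrite (@eval_iter_Node _ C.*2 _ 0) // (@eval_iter_Node _ C _ 0) // !addn0.
  by [].
lia.
Qed.

Lemma exec_base s w a x2 x3 x4 x5 x6 x7 x8 x9 x10 x11 x12 t n L :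
  exec R (size L * 4 + 5) base_prog
    (st M s [:: w; enc_unary a; x2; x3; x4; x5; x6; x7; x8; x9; x10; x11; x12; node t (node n (enc_sets L))])
    (st M s [:: leaf; enc_unary a; x2; x3; x4; enc_sets (base_sets a L); x6; x7; x8; x9; x10; x11; x12; node t (node n (enc_sets L))]).
Proof.
pose I K acc := st M s [:: enc_sets K; enc_unary a; x2; x3; x4; enc_sets acc; x6; x7; x8; x9; x10; x11; x12; node t (node n (enc_sets L))].
have h := @exec_foldl R _ _ (fun=> True) 3 (V 0)
  (Seq (W 5 (Node (Node (Node Leaf (V 1)) (Left (V 0))) (V 5))) (W 0 (Right (V 0))))
  (fun acc s => (a.+1 :: s) :: acc) I _ _ L [:: [:: a; a.+1]] Logic.I.
refine (@exec_prefix _ _ _ (I L [:: [:: a; a.+1]]) _ _ _ _ _ (h _ _) _) => //.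
- by run.
- move=> x s' y _; rewrite /I; split=> //; first by run.
  by apply: exec_straight => //; run.
- by move=> y; rewrite /I; run.
- by rewrite /=; lia.
Qed.

Definition bits_val (bs : seq bool) : nat := foldr (fun (b : bool) acc => b + acc.*2) 0 bs.

Lemma exec_rev s w x1 x2 x3 x5 x6 x7 x8 x9 x10 x11 x12 sg bs x :
  exec R (size bs * 4 + 3) rev_prog
    (st M s [:: w; x1; x2; x3; leaf; x5; x6; x7; x8; x9; x10; x11; x12; node (node sg (enc_seq (map enc_bool bs))) x])
    (st M s [:: leaf; x1; x2; x3; enc_seq (map enc_bool (rev bs)); x5; x6; x7; x8; x9; x10; x11; x12; node (node sg (enc_seq (map enc_bool bs))) x]).
Proof.
have revE : rev bs = foldl (fun acc b => b :: acc) [::] bs.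
  by rewrite /rev; elim: bs [::] => //=.
rewrite revE; pose I K acc := st M s [:: enc_seq (map enc_bool K); x1; x2; x3; enc_seq (map enc_bool acc); x5; x6; x7; x8; x9; x10; x11; x12; node (node sg (enc_seq (map enc_bool bs))) x].
have h := @exec_foldl R _ _ (fun=> True) 3 (V 0)
  (Seq (W 4 (Node (Left (V 0)) (V 4))) (W 0 (Right (V 0))))
  (fun acc b => b :: acc) I _ _ bs [::] Logic.I.
refine (@exec_prefix _ _ _ (I bs [::]) _ _ _ _ _ (h _ _) _) => //.
- by run.
- move=> b s' y _; rewrite /I; split=> //; first by run.
  by apply: exec_straight => //; run.
- by move=> y; rewrite /I; run.
- by rewrite /=; lia.
Qed.

Lemma exec_add s w u n x1 x4 x5 x6 x7 x8 x9 x10 x11 x12 x13 :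
  exec R (w * 8).+1 (While (V 0) add_body)
    (st M s [:: enc_unary w; x1; enc_unary (minn u n); enc_unary (n - u); x4; x5; x6; x7; x8; x9; x10; x11; x12; x13])
    (st M s [:: leaf; x1; enc_unary (minn (u + w) n); enc_unary (n - (u + w)); x4; x5; x6; x7; x8; x9; x10; x11; x12; x13]).
Proof.
pose I j := st M s [:: enc_unary (w - j); x1; enc_unary (minn (u + j) n);
  enc_unary (n - (u + j)); x4; x5; x6; x7; x8; x9; x10; x11; x12; x13].
suff h : exec R (w * 8).+1 (While (V 0) add_body) (I 0) (I w).
  by rewrite /I subn0 addn0 subnn in h.
apply: exec_loop => [j jw|]; last by rewrite /I subnn; run.
split; first by rewrite /I; run; rewrite is_leaf_unary; lia.
apply: exec_straight => //; rewrite /I; run.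
rewrite is_leaf_unary; case: eqP => h.
  rewrite update_id; run; rewrite right_of_unary.
  by congr (st M s [:: enc_unary _; _; enc_unary _; enc_unary _; _; _; _; _; _; _; _; _; _; _]); lia.
run; rewrite !right_of_unary -enc_unaryS.
by congr (st M s [:: enc_unary _; _; enc_unary _; enc_unary _; _; _; _; _; _; _; _; _; _; _]); lia.
Qed.

Lemma exec_min s w x1 x5 x6 x7 x8 x9 x10 x11 x12 t n L bs :
  exec R (size bs * (8 * n + 20) + 3) min_prog
    (st M s [:: leaf; x1; leaf; w; enc_seq (map enc_bool (rev bs)); x5; x6; x7; x8; x9; x10; x11; x12; node t (node (enc_unary n) L)])
    (st M s [:: leaf; x1; enc_unary (minn (bits_val bs) n); enc_unary (n - bits_val bs); leaf; x5; x6; x7; x8; x9; x10; x11; x12; node t (node (enc_unary n) L)]).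
Proof.
pose I K u := st M s [:: leaf; x1; enc_unary (minn u n); enc_unary (n - u);
  enc_seq (map enc_bool K); x5; x6; x7; x8; x9; x10; x11; x12; node t (node (enc_unary n) L)].
pose f u (b : bool) := minn (b + u.*2) n.
have h := @exec_foldl R _ _ (fun u => u <= n) (8 * n + 19) (V 4) min_body f I _ _ (rev bs) 0 isT.
(* Capping at n after each Horner step equals capping once at the end: a value that has reached n
   stays at least n when doubled. *)
have valE : foldl f 0 (rev bs) = minn (bits_val bs) n.
  rewrite foldl_rev; elim: {h} bs => [|b bs IH] /=; first by rewrite min0n.
  by rewrite {1}/f IH; lia.
have IE : I [::] (foldl f 0 (rev bs)) = I [::] (bits_val bs).
  rewrite valE /I -minnA minnn.
  by rewrite (_ : n - minn (bits_val bs) n = n - bits_val bs) //; lia.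
rewrite IE size_rev in h.
refine (@exec_prefix _ _ _ (I (rev bs) 0) _ _ _ _ _ (h _ _) _) => //.
- by rewrite /I; run; rewrite min0n subn0.
- move=> b K u un; split; first by rewrite /I; run.
    by rewrite geq_minr.
  have hw := @exec_add s (b + u) u n x1 (enc_seq (map enc_bool (b :: K))) x5 x6 x7 x8 x9 x10 x11 x12
    (node t (node (enc_unary n) L)).
  have hb : exec R (8 * n + 12) (Seq (While (V 0) add_body) (W 4 (Right (V 4))))
      (st M s [:: enc_unary (b + u); x1; enc_unary (minn u n);
        enc_unary (n - u); enc_seq [seq enc_bool i | i <- b :: K]; x5; x6; x7; x8; x9; x10; x11; x12; node t (node (enc_unary n) L)])
      (I K (f u b)).
    refine (@exec_suffix _ _ _ _ _ _ _ hw _ _ _) => //=; last by case: (b); lia.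
    run; rewrite /I /f.
    by congr (st M s [:: _; _; enc_unary _; enc_unary _; _; _; _; _; _; _; _; _; _; _]); lia.
  refine (@exec_prefix _ _ _ _ _ _ _ _ _ hb _) => //=; last lia.
  rewrite /I; run; rewrite (minn_idPl un); case: (b) => /=; last by rewrite update_id.
  by run.
- by move=> u; rewrite /I; run.
- rewrite /=; lia.
Qed.

Definition enc_state (b u : nat) (L : seq (seq nat)) : tree :=
  node (enc_unary (p * b)) (node (enc_unary u) (enc_sets L)).

Definition dfs_store s r x2 x3 x4 x5 x8 x9 x10 x11 x12 x13 (w S O : tree) : store :=
  st M s [:: w; enc_unary r; x2; x3; x4; x5; S; O; x8; x9; x10; x11; x12; x13].

Lemma eval_child s r x2 x3 x4 x5 x8 x9 x10 x11 x12 x13 b u L S O d :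
  eval (dfs_store s r x2 x3 x4 x5 x8 x9 x10 x11 x12 x13 (enc_state b.+1 u L) S O) (child d) =
  enc_state b (u - d) (at_most p r d (p * b.+1) ++ L).
Proof.
set s0 := dfs_store _ _ _ _ _ _ _ _ _ _ _ _ _ _ _.
have E0 : s0 (M + 0) = enc_state b.+1 u L by rewrite /s0 /dfs_store; run.
have E1 : s0 (M + 1) = enc_unary r by rewrite /s0 /dfs_store; run.
rewrite [eval _ _]/=; congr node; last congr node.
- rewrite (@eval_iter_Right _ p _ (p * b.+1)); last by rewrite /= E0.
  by rewrite mulnS addKn.
- by rewrite (@eval_iter_Right _ d _ u) // /= E0.
- apply: eval_cons_sets; last by rewrite /= E0.
  rewrite /guess_exprs /at_most.
  transitivity (map (cons (enc_unary r)) (map (map (eval s0))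
      (combs d.+1 [seq iter j Right (Left (V 0)) | j <- iota 1 p]))).
    by rewrite -!map_comp; apply: eq_map => c; rewrite /= E1.
  transitivity (map (cons (enc_unary r)) (map (map enc_unary)
      (combs d.+1 (block p (p * b.+1))))); last first.
    by rewrite -!map_comp; apply: eq_map => c.
  rewrite !map_combs; congr (map _ (combs _ _)).
  rewrite /block -!map_comp; apply: eq_map => j /=.
  by rewrite (@eval_iter_Right _ j _ (p * b.+1)) // /= E0.
Qed.

Definition push_tree (r b u : nat) (L : seq (seq nat)) (S : tree) (d : nat) : tree :=
  if d <= u then node (enc_state b (u - d) (at_most p r d (p * b.+1) ++ L)) S else S.

Lemma straight_pushes ds : straight (pushes ds).
Proof. by elim: ds. Qed.

Lemma cost_pushes ds : cost (pushes ds) = size ds * 4 + 1.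
Proof. elim: ds => //= d ds ->; lia. Qed.

Lemma den_push s r x2 x3 x4 x5 x8 x9 x10 x11 x12 x13 b u L S O d :
  den (push d) (dfs_store s r x2 x3 x4 x5 x8 x9 x10 x11 x12 x13 (enc_state b.+1 u L) S O) =
  dfs_store s r x2 x3 x4 x5 x8 x9 x10 x11 x12 x13 (enc_state b.+1 u L) (push_tree r b u L S d) O.
Proof.
have := @eval_child s r x2 x3 x4 x5 x8 x9 x10 x11 x12 x13 b u L S O d.
set s0 := dfs_store _ _ _ _ _ _ _ _ _ _ _ _ _ _ _ => Ec.
rewrite [LHS](_ : _ = (if is_leaf (eval s0 (iter d Right (Node Leaf (Left (Right (V 0))))))
  then den nop s0 else update s0 (M + 6) (node (eval s0 (child d)) (eval s0 (V 6))))) //.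
rewrite (@eval_iter_Right _ d _ u.+1); last by rewrite /s0 /dfs_store; run.
rewrite is_leaf_unary subn_eq0 /push_tree ltnNge.
case: leqP => du; last exact: update_id.
by rewrite Ec /s0 /dfs_store; run.
Qed.

Lemma den_pushes s r x2 x3 x4 x5 x8 x9 x10 x11 x12 x13 b u L S O ds :
  den (pushes ds) (dfs_store s r x2 x3 x4 x5 x8 x9 x10 x11 x12 x13 (enc_state b.+1 u L) S O) =
  dfs_store s r x2 x3 x4 x5 x8 x9 x10 x11 x12 x13 (enc_state b.+1 u L) (foldl (push_tree r b u L) S ds) O.
Proof.
elim: ds S => [|d ds IH] S; first exact: update_id.
by rewrite [LHS](_ : _ = den (pushes ds) (den (push d) (dfs_store s r x2 x3 x4 x5 x8 x9 x10 x11 x12 x13 (enc_state b.+1 u L) S O))) // den_push IH.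
Qed.

Definition dfs_cost1 : nat := 4 * p + 14.

Fixpoint dfs_cost (b : nat) : nat :=
  if b is b'.+1 then dfs_cost1 + p.+1 * dfs_cost b' else dfs_cost1.

Lemma cost_dfs_body : (cost dfs_body).+1 <= dfs_cost1.
Proof. rewrite /dfs_body [cost _]/= -/(pushes (iota 0 p.+1)) cost_pushes size_iota /dfs_cost1; lia. Qed.

Definition out_tree (Ls : seq (seq (seq nat))) (O : tree) : tree :=
  foldr node O (map enc_sets Ls).

Lemma out_tree_cat Ls Ls' O : out_tree (Ls ++ Ls') O = out_tree Ls (out_tree Ls' O).
Proof. by rewrite /out_tree map_cat foldr_cat. Qed.

(** Children are pushed by increasing [d], hence treated by decreasing [d], and every output goes in
    front of the earlier ones. The two reversals cancel, so the instances appear in the order of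
    [guesses]; the inner induction accordingly runs from the end of the list of children. *)
Lemma safe_dfs (wr : store -> bool) T (v : R) q s r x2 x3 x4 x5 x8 x9 x10 x11 x12 x13 b u L w S O :
  0 < p ->
  let dst := dfs_store s r x2 x3 x4 x5 x8 x9 x10 x11 x12 x13 in
  (forall w', safe wr T v (While (V 6) dfs_body :: q, dst w' S (out_tree (guesses p r b u L) O))) ->
  safe wr (dfs_cost b + T) v (While (V 6) dfs_body :: q, dst w (node (enc_state b u L) S) O).
Proof.
move=> p0 dst; elim: b u L w S O T => [|b IH] u L w S O T h.
  apply: safe_weaken (leq_add cost_dfs_body (leqnn T)) (lexx v) _.
  rewrite addSn; apply: safe_step => bit.
  have hb := @exec_den R dfs_body (dst w (node (enc_state 0 u L) S) O).
  rewrite [step _ _](_ : _ = ([:: dfs_body, While (V 6) dfs_body & q], dst w (node (enc_state 0 u L) S) O)); last first.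
    by rewrite /dst /dfs_store; run.
  apply: hb; first by rewrite /= straight_pushes.
  have -> : den dfs_body (dst w (node (enc_state 0 u L) S) O) =
      dst (enc_state 0 u L) S (out_tree (guesses p r 0 u L) O).
    by rewrite /dst /dfs_store; run; rewrite muln0; run.
  exact: h.
have hds ds : forall S O T, 
    (forall w', safe wr T v (While (V 6) dfs_body :: q, dst w' S (out_tree
      (flatten [seq if d <= u then guesses p r b (u - d) (at_most p r d (p * b.+1) ++ L)
         else [::] | d <- ds]) O))) ->
    forall w, safe wr (size ds * dfs_cost b + T) v
     (While (V 6) dfs_body :: q, dst w (foldl (push_tree r b u L) S ds) O).
  elim/last_ind: ds {h S O T w} => [|ds d IHds] S O T h w; first exact: h.
  rewrite -cats1 foldl_cat /= size_cat /= addn1 mulSn -addnA {1}/push_tree.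
  rewrite -cats1 map_cat flatten_cat /= cats0 in h.
  case: leqP h => du h.
    apply: IH => w'; apply: IHds => w''.
    by rewrite -out_tree_cat.
  apply: (safe_weaken (T := size ds * dfs_cost b + T) (v := v)) => //; first lia.
  by apply: IHds => w'; move: (h w'); rewrite cats0.
rewrite -[dfs_cost _]/(dfs_cost1 + p.+1 * dfs_cost b) -addnA.
apply: safe_weaken (leq_add cost_dfs_body (leqnn _)) (lexx v) _.
rewrite addSn; apply: safe_step => bit.
rewrite [step _ _](_ : _ = ([:: dfs_body, While (V 6) dfs_body & q], dst w (node (enc_state b.+1 u L) S) O)); last first.
  by rewrite /dst /dfs_store; run.
have hb := @exec_den R dfs_body (dst w (node (enc_state b.+1 u L) S) O).
apply: hb; first by rewrite /= straight_pushes.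
have -> : den dfs_body (dst w (node (enc_state b.+1 u L) S) O) =
    dst (enc_state b.+1 u L) (foldl (push_tree r b u L) S (iota 0 p.+1)) O.
  rewrite /dst -den_pushes /dfs_body.
  set P := pushes _; rewrite /dfs_store; run.
  by rewrite is_leaf_unary ifN // muln_eq0 negb_or -lt0n p0.
by have := hds (iota 0 p.+1) S O T h (enc_state b.+1 u L); rewrite size_iota.
Qed.

End Phases.
End Program.

(** * Majority votes *)

Section Votes.
Variables (R : realType) (M : nat) (A : cmd).
Hypothesis M0 : (0 < M)%N.
Hypothesis A_below : cmd_below M A.
Variables (TA a K : nat).

Let V i := Var (M + i).
Let W i e := Assign (M + i) e.
Let nop := skip M.

Definition accepting (s : store) : bool := ~~ is_leaf (s 0%N).

Definition decides (x : tree) (ans : bool) : Prop :=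
  let c := init A (node (enc_unary a.+2) x) in
  halts TA c /\ err R (fun s => accepting s != ans) TA c <= 1 / 3.

Definition vote_cost : nat := (M.*2 + TA + 12)%N.

(* The error credit 2 ^ w (4 / 3) ^ j / 2 ^ K after w wrong votes, with j votes
   to come, is a supermartingale, as 2 / 3 * 1 + 1 / 3 * 2 = 4 / 3. *)
Lemma safe_vote (wr : store -> bool) T (v : R) q s j w x ans
    x0 x2 x3 x4 x5 x6 O x8 x9 x12 x13 :
  decides x ans -> (w + j <= K.*2)%N ->
  (forall s' y, safe wr T (v + ((y == 0%N) != ans)%:R)
    (q, st M s' [:: x0; enc_unary a; x2; x3; x4; x5; x6; node x O; x8; x9; leaf; enc_unary y; x12; x13])) ->
  safe wr (j * vote_cost + 1 + T)%N (v + 2 ^+ w * (4 / 3) ^+ j / 2 ^+ K)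
    (While (V 10) (vote_body M A) :: q,
     st M s [:: x0; enc_unary a; x2; x3; x4; x5; x6; node x O; x8; x9; enc_unary j;
       enc_unary (K - (if ans then K.*2 - j - w else w))%N; x12; x13]).
Proof.
move=> [hA eA] + hq; elim: j w s => [|j IH] w s wj.
  apply: exec_while_stop; first by run.
  apply: safe_weaken (hq s _) => //.
  rewrite expr0 mulr1 lerD2l.
  case: eqP => h /=; first by rewrite divr_ge0 ?exprn_ge0.
  (* Whatever the right answer is, a wrong verdict takes at least [K] wrong votes, and then the
     remaining credit 2 ^ w / 2 ^ K is at least 1. *)
  have Kw : (K <= w)%N by move: h; case: (ans); case: eqP; lia.
  by rewrite ler_pdivlMr ?exprn_gt0 // mul1r ler_eXn2l // ltr1n.
pose l yes i := [:: x0; enc_unary a; x2; x3; x4; x5; x6; node x O; x8; x9; enc_unary i; enc_unary yes; x12; x13].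
pose c0 := st M s (l (K - (if ans then K.*2 - j.+1 - w else w))%N j.+1).
pose inp := node (enc_unary a.+2) x.
pose T' := (j * vote_cost + 1 + T)%N.
pose rest := Seq (If (Var 0) (W 11 (Right (V 11))) nop) (W 10 (Right (V 10))).
pose yes := (if ans then K.*2 - j.+1 - w else w)%N.
rewrite -/yes.
apply: (safe_weaken (T := ((M.*2 + 3 + (TA + (5 + T')).+1).+1.+1)%N)
  (v := 2 / 3 * (v + 2 ^+ w * (4 / 3) ^+ j / 2 ^+ K) + 1 / 3 * (v + 2 ^+ w.+1 * (4 / 3) ^+ j / 2 ^+ K))).
- rewrite /T' /vote_cost; nia.
- by rewrite !exprS; lra.
apply: safe_step => b.
rewrite [step _ _](_ : _ = ([:: vote_body M A, While (V 10) (vote_body M A) & q], st M s (l (K - yes)%N j.+1))); last first.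
  by rewrite /l; run.
apply: safe_step => b'; rewrite [step _ _]/=.
have hprep : exec R (M.*2 + 3) (Seq (reset M) (Assign 0 (Node (Node Leaf (Node Leaf (V 1))) (Left (V 7)))))
    (st M s (l (K - yes)%N j.+1)) (st M (update (fun=> leaf) 0 inp) (l (K - yes)%N j.+1)).
  refine (@exec_suffix _ _ _ _ _ _ _ _ (@exec_reset R M _ _) _ _ _) => //=; last lia.
  by rewrite st_upd_low // /l; run.
apply: hprep; apply: safe_step => b''; rewrite [step _ _]/= -/rest.
have := @safe_sub_third R wr (fun s => accepting s != ans) M TA (5 + T')
   (v + 2 ^+ w * (4 / 3) ^+ j / 2 ^+ K) (v + 2 ^+ w.+1 * (4 / 3) ^+ j / 2 ^+ K)
   [:: A] (update (fun=> leaf) 0 inp) [:: rest, While (V 10) (vote_body M A) & q]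
   (l (K - yes)%N j.+1).
apply => //=; first by rewrite A_below.
  rewrite lerD2l ler_pM2r ?invr_gt0 ?exprn_gt0 // ler_pM2r ?exprn_gt0 ?divr_gt0 //.
  by rewrite exprS ler_peMl ?exprn_ge0 // ler1n.
move=> s'.
have hrest := @exec_den R rest (st M s' (l (K - yes)%N j.+1)) isT.
apply: hrest.
have -> : den rest (st M s' (l (K - yes)%N j.+1)) =
    st M s' (l (K - (yes + accepting s'))%N j).
  rewrite /rest /l /accepting; run; rewrite st_low //.
  case: (is_leaf _); first by rewrite update_id addn0; run.
  by run; rewrite right_of_unary addn1 subnS.
have E : (yes + accepting s')%N =
    (if ans then K.*2 - j - (if accepting s' != ans then w.+1 else w)
     else if accepting s' != ans then w.+1 else w)%N.
  by rewrite /yes; case: (ans) (accepting s') => -[] /=; lia.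
rewrite E; case: ifP => _; apply: IH; lia.
Qed.

Definition test_cost : nat := (K.*2 * vote_cost + 12)%N.

(** A union bound: each instance contributes [d]. Once [ok] is false, a verdict may have been wrong;
    the credit then contains a full 1, and nothing more is required of the final answer. *)
Lemma safe_test (wr : store -> bool) (goal : bool) T q s (xs : seq (tree * bool)) (fb ok : bool)
    (d : R) x0 x2 x3 x4 x5 x6 x10 x11 x13 :
  (8 / 9) ^+ K <= d ->
  (forall x, List.In x xs -> decides x.1 x.2) ->
  (forall s' x10 x11 (fb' : bool), safe (R := R) wr T ((~~ (fb' == goal))%:R)
    (q, st M s' [:: x0; enc_unary a; x2; x3; x4; x5; x6; leaf; enc_unary K.*2; enc_unary K; x10; x11; enc_bool fb'; x13])) ->
  (ok -> (fb || has snd xs) = goal) ->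
  safe wr (size xs * test_cost + 1 + T)%N ((~~ ok)%:R + (size xs)%:R * d)
    (While (V 7) (test_body M A) :: q,
     st M s [:: x0; enc_unary a; x2; x3; x4; x5; x6; enc_seq (map fst xs); enc_unary K.*2; enc_unary K; x10; x11;
       enc_bool fb; x13]).
Proof.
move=> hd + hq; elim: xs fb ok s x10 x11 => [|[x ans] xs IH] fb ok s x10 x11 hxs hok.
  apply: exec_while_stop; first by run.
  apply: safe_weaken (hq s _ _ _) => //.
  rewrite mul0r addr0; case: ok hok => [/(_ isT)|_]; last by case: (_ == _).
  by rewrite orbF => ->; rewrite eqxx.
have hx : decides x ans by apply: (hxs (x, ans)); left.
pose T' := (size xs * test_cost + 1 + T)%N.
pose v := (~~ ok)%:R + (size xs)%:R * d.
pose l y1 y2 y7 f := [:: x0; enc_unary a; x2; x3; x4; x5; x6; y7; enc_unary K.*2; enc_unary K; y1; y2; f; x13].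
apply: (safe_weaken (T := ((3 + (K.*2 * vote_cost + 1 + (5 + T'))).+1.+1.+1)%N)
  (v := v + 2 ^+ 0 * (4 / 3) ^+ K.*2 / 2 ^+ K)).
- rewrite /T' [size (_ :: _)]/= mulSn {2}/test_cost; lia.
- have E : (4 / 3) ^+ K.*2 / 2 ^+ K = (8 / 9) ^+ K :> R.
    by rewrite -mul2n exprM -expr_div_n; congr (_ ^+ K); lra.
  rewrite /v expr0 mul1r E [size (_ :: _)]/= [(size xs).+1%:R]mulrSr; lra.
apply: safe_step => b.
rewrite [step _ _](_ : _ = ([:: test_body M A, While (V 7) (test_body M A) & q],
  st M s (l x10 x11 (enc_seq (map fst ((x, ans) :: xs))) (enc_bool fb)))); last first.
  by rewrite /l; run.
apply: safe_step => b'; rewrite [step _ _]/=.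
have hprep : exec R 3 (Seq (W 10 (V 8)) (W 11 (V 9)))
   (st M s (l x10 x11 (enc_seq (map fst ((x, ans) :: xs))) (enc_bool fb)))
   (st M s (l (enc_unary K.*2) (enc_unary K) (enc_seq (map fst ((x, ans) :: xs))) (enc_bool fb))).
  by apply: exec_straight => //; rewrite /l; run.
apply: hprep; apply: safe_step => b''; rewrite [step _ _]/=.
have K0 : K = (K - (if ans then K.*2 - K.*2 - 0 else 0))%N by rewrite subnn sub0n if_same subn0.
have := @safe_vote wr (5 + T') v [:: Seq (If (V 11) nop (W 12 (Node Leaf Leaf))) (W 7 (Right (V 7))),
    While (V 7) (test_body M A) & q] s K.*2 0 x ans x0 x2 x3 x4 x5 x6 (enc_seq (map fst xs))
    (enc_unary K.*2) (enc_unary K) (enc_bool fb) x13 hx (leqnn _).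
rewrite -K0; apply => s' y.
rewrite -/(l leaf (enc_unary y) (enc_seq (map fst ((x, ans) :: xs))) (enc_bool fb)).
set q1 := If (V 11) _ _.
have hend : exec R 5 (Seq q1 (W 7 (Right (V 7))))
   (st M s' (l leaf (enc_unary y) (enc_seq (map fst ((x, ans) :: xs))) (enc_bool fb)))
   (st M s' (l leaf (enc_unary y) (enc_seq (map fst xs)) (enc_bool (fb || (y == 0%N))))).
  apply: exec_straight => //; rewrite /q1 /l; run; rewrite is_leaf_unary.
  by case: eqP => _; [run; rewrite orbT|rewrite update_id orbF; run].
apply: hend.
have : safe wr T' ((~~ (ok && ((y == 0%N) == ans)))%:R + (size xs)%:R * d)
    (While (V 7) (test_body M A) :: q,
      st M s' (l leaf (enc_unary y) (enc_seq (map fst xs)) (enc_bool (fb || (y == 0%N))))).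
  apply: IH => [z hz|/andP[/hok <- /eqP ->]]; first by apply: hxs; right.
  by rewrite /= orbA.
apply: safe_weaken => //; rewrite /v.
by case: (ok) => /=; case: (y == 0%N); case: (ans) => /=; lra.
Qed.

End Votes.

(** * Correctness of the program *)

Lemma mem_List_In (T : eqType) (x : T) s : List.In x s -> x \in s.
Proof. by elim: s => //= y s IH [->|/IH xs]; rewrite inE ?eqxx // xs orbT. Qed.

Lemma bits_of_natK N : bits_val (bits_of_nat N) = N.
Proof.
rewrite -[RHS]bin_of_natK /bits_of_nat.
case: (bin_of_nat N) => //= q; elim: q => //= q ->; rewrite NatTrec.doubleE //.
Qed.

Lemma enc_family_nat (I : hs_instance) :
  enc_family (hs_sets I) = node (enc_unary (hs_n I)) (enc_sets (hs_nat I)).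
Proof.
rewrite /enc_family /enc_sets /hs_nat -map_comp; congr (node _ (enc_seq _)).
by apply: eq_map => s /=; rewrite -map_comp.
Qed.

Lemma encode_ss_of a L : all (all (fun x => x < a.+2)%N) L ->
  enc_family (ss_sets (ss_of a L)) = node (enc_unary a.+2) (enc_sets L).
Proof.
move=> /allP hL; rewrite /enc_family /enc_sets /= -map_comp; congr (node _ (enc_seq _)).
apply/eq_in_map => s /hL /allP hs /=; rewrite -map_comp; congr enc_seq.
by apply/eq_in_map => x /hs /= hx; rewrite inordK.
Qed.

Lemma leq_ceil p n b : (0 < p -> b = (n + p.-1) %/ p -> n <= p * b)%N.
Proof.
move=> p0 ->; have := divn_eq (n + p.-1) p; have := ltn_pmod (n + p.-1) p0.
by rewrite [(p * _)%N]mulnC; lia.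
Qed.

Lemma ceil_leq p n b : (0 < p -> b = (n + p.-1) %/ p -> p * b.-1 <= n)%N.
Proof.
move=> p0 ->; have := divn_eq (n + p.-1) p; have := ltn_pmod (n + p.-1) p0.
case: (_ %/ _)%N => [|b'] /=; rewrite ?muln0 // mulSn [(p * _)%N]mulnC; lia.
Qed.

Definition hs_steps (M p C TA n b nL nb : nat) : nat :=
  (b * 8 + nL * 4 + nb * (8 * n + 24) + dfs_cost p b
   + p.+1 ^ b * test_cost M TA (b.+1 * C) + 50)%N.

Lemma safe_hs_prog (R : realType) (M p C TA b : nat) (A : cmd) (I : hs_instance) :
  (0 < M)%N -> cmd_below M A -> (0 < p)%N ->
  b = ((hs_n I + p.-1) %/ p)%N ->
  (8 / 9) ^+ C * p.+1%:R <= 1 / 3 :> R ->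
  (forall L, L \in hs_guesses p b I ->
    decides R A TA (p * b) (enc_sets L)
      (has_splitting (family_of (ss_sets (ss_of (p * b) L))))) ->
  safe (R := R) (fun s => accepting s != has_hitting_set (family_of (hs_sets I)) (hs_t I))
    (hs_steps M p C TA (hs_n I) b (size (hs_nat I)) (size (bits_of_nat `|hs_t I|%N))) (1 / 3)
    (init (hs_prog M p C A) (node (enc_int (hs_t I)) (enc_family (hs_sets I)))).
Proof.
move=> M0 hA p0 bE hC hdec.
set inp := node _ _; set goal := has_hitting_set _ _; set wr := fun s => _.
pose s0 : store := fun=> leaf.
rewrite /init (_ : update _ _ _ = st M (update s0 0 inp) (nseq 14 leaf)); last first.
  apply: funext => y; rewrite /st nth_nseq if_same /update.
  by case: ltnP => // My; rewrite ifN //; lia.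
set T := hs_steps _ _ _ _ _ _ _ _.
have inpE : inp = node (node (enc_bool (hs_t I < 0)) (enc_seq (map enc_bool (bits_of_nat `|hs_t I|%N))))
    (node (enc_unary (hs_n I)) (enc_sets (hs_nat I))).
  by rewrite /inp enc_family_nat.
clearbody inp.
pose l0 := [:: leaf; leaf; leaf; leaf; leaf; leaf; leaf; leaf; leaf; leaf; leaf; leaf; leaf; inp].
pose sa := update s0 0 inp.
have hstart T' v : safe (R := R) wr T' v
    ([:: If (Left (Left (Var (M + 13)))) (Assign 0 Leaf) (main_prog M p C A)], st M sa l0) ->
    safe (R := R) wr T'.+2 v ([:: hs_prog M p C A], st M sa (nseq 14 leaf)).
  move=> h; apply: safe_step => b1; rewrite [step _ _]/=.
  apply: safe_step => b2; rewrite [step _ _](_ : _ = ([:: If (Left (Left (Var (M + 13)))) (Assign 0 Leaf) (main_prog M p C A)], st M sa l0)) //.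
  by run; rewrite st_low.
(* No set has negative cardinality, so a negative t is rejected without any call. *)
have [tneg|tpos] := ltP (hs_t I) 0.
  have goalF : goal = false.
    apply/negbTE/existsP => -[H /andP[+ _]].
    by rewrite leNgt (lt_le_trans tneg).
  apply: (safe_weaken (T := 4%N) (v := 0)); [by rewrite /T /hs_steps; lia|by lra|].
  apply: hstart; apply: safe_step => b1; rewrite [step _ _](_ : _ = ([:: Assign 0 Leaf], st M sa l0)); last first.
    by run; rewrite inpE tneg.
  apply: safe_step => b2; apply: safe_halted => //.
  by rewrite /wr /accepting goalF.
set L := hs_nat I; set n := hs_n I; set bs := bits_of_nat `|hs_t I|%N.
set K := (b.+1 * C)%N; set a := (p * b)%N.
set u := minn `|hs_t I|%N n.
have uE : u = minn (bits_val bs) n by rewrite bits_of_natK.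
pose Ls := hs_guesses p b I.
pose f (L : seq (seq nat)) := (enc_sets L, has_splitting (family_of (ss_sets (ss_of a L)))).
have sLs : (size Ls <= p.+1 ^ b)%N by apply: size_guesses.
pose pre := Seq (pad_prog M p C) (Seq (base_prog M) (Seq (rev_prog M) (min_prog M))).
pose l1 := [:: leaf; enc_unary a; enc_unary u; enc_unary (n - bits_val bs); leaf; enc_sets (base_sets a L);
   leaf; leaf; enc_unary K.*2; enc_unary K; leaf; leaf; leaf; inp].
have hpre : exec R (b * 8 + size L * 4 + size bs * (8 * n + 24) + 22) pre (st M sa l0) (st M sa l1).
  have h1 := @exec_pad M p C R sa leaf leaf leaf leaf leaf leaf leaf leaf leaf leaf leaf leaf
    (node (enc_bool (hs_t I < 0)) (enc_seq (map enc_bool bs))) (enc_sets L) n b p0 bE.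
  have h2 := @exec_base M R sa leaf a leaf leaf leaf leaf leaf leaf (enc_unary (b.+1 * C.*2)) (enc_unary K) leaf leaf leaf
    (node (enc_bool (hs_t I < 0)) (enc_seq (map enc_bool bs))) (enc_unary n) L.
  have h3 := @exec_rev M R sa leaf (enc_unary a) leaf leaf (enc_sets (base_sets a L)) leaf leaf (enc_unary (b.+1 * C.*2)) (enc_unary K) leaf leaf leaf
    (enc_bool (hs_t I < 0)) bs (node (enc_unary n) (enc_sets L)).
  have h4 := @exec_min M R sa leaf (enc_unary a) (enc_sets (base_sets a L)) leaf leaf (enc_unary (b.+1 * C.*2)) (enc_unary K) leaf leaf leaf
    (node (enc_bool (hs_t I < 0)) (enc_seq (map enc_bool bs))) n (enc_sets L) bs.
  rewrite -doubleMr in h1 h2 h3 h4; rewrite -uE in h4.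
  rewrite /l0 /l1 inpE.
  refine (exec_mono _ (exec_seq h1 (exec_seq h2 (exec_seq h3 h4)))); lia.
set T1 := (b * 8 + size L * 4 + size bs * (8 * n + 24) + 22)%N in hpre.
pose l2 w S O := [:: w; enc_unary a; enc_unary u; enc_unary (n - bits_val bs); leaf; enc_sets (base_sets a L);
   S; O; enc_unary K.*2; enc_unary K; leaf; leaf; leaf; inp].
pose xs := map f Ls.
have sxs : size xs = size Ls by rewrite size_map.
pose T2 := (size xs * test_cost M TA K + 1 + 1)%N.
apply: (safe_weaken (T := (T1 + (dfs_cost p b + (T2.+2)).+3).+2.+2)
  (v := (~~ true)%:R + (size xs)%:R * ((8 / 9) ^+ K))).
- rewrite /T2 sxs /T /hs_steps -/n -/L -/bs -/K.
  have := leq_mul2r (test_cost M TA K) (size Ls) (p.+1 ^ b); rewrite sLs orbT.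
  by rewrite /T1; lia.
(* With d = (8/9)^C, the union bound is (p+1)^b d^(b+1) = ((p+1) d)^b d <= d <= 1/3, which is why
   [K] has the factor b + 1. *)
- rewrite add0r sxs /K exprM.
  apply: (@le_trans _ _ ((p.+1%:R) ^+ b * (8 / 9) ^+ (b.+1 * C))).
    rewrite exprM ler_wpM2r ?exprn_ge0 //; try by rewrite divr_ge0.
    by rewrite -natrX ler_nat.
  have d0 : 0 <= (8 / 9) ^+ C :> R by rewrite exprn_ge0 // divr_ge0.
  set d := (8 / 9) ^+ C in d0 hC *.
  have p1 : 1 <= p.+1%:R :> R by rewrite ler1n.
  rewrite mulnC exprM -/d exprS mulrCA -exprMn mulrC.
  have h1 : (p.+1%:R * d) ^+ b <= 1 by rewrite exprn_ile1 // ?mulr_ge0 //; lra.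
  have h2 : d <= 1 / 3 by nra.
  have h3 : 0 <= (p.+1%:R * d) ^+ b by rewrite exprn_ge0 // mulr_ge0.
  by nra.
apply: hstart; apply: safe_step => b1; rewrite [step _ _](_ : _ = ([:: main_prog M p C A], st M sa l0)); last first.
  by rewrite /l0; run; rewrite inpE ltNge tpos.
apply: safe_step => b2; rewrite [step _ _]/= -/pre.
apply: hpre.
apply: safe_step => b3; rewrite [step _ _]/=.
apply: safe_step => b4; rewrite [step _ _](_ : _ = ([:: Seq (While (Var (M + 6)) (dfs_body M p))
   (Seq (While (Var (M + 7)) (test_body M A)) (Assign 0 (Var (M + 12))))],
   st M sa (l2 leaf (node (enc_state p b u (base_sets a L)) leaf) leaf))); last first.
  by rewrite /l1 /l2 /enc_state; run.
apply: safe_step => b5; rewrite [step _ _]/=.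
have := @safe_dfs M p R wr (T2.+2) ((~~ true)%:R + (size xs)%:R * (8 / 9) ^+ K)
   [:: Seq (While (Var (M + 7)) (test_body M A)) (Assign 0 (Var (M + 12)))]
   sa a (enc_unary u) (enc_unary (n - bits_val bs)) leaf (enc_sets (base_sets a L))
   (enc_unary K.*2) (enc_unary K) leaf leaf leaf inp b u (base_sets a L) leaf leaf leaf p0.
apply => w.
apply: (exec_while_stop); first by rewrite /dfs_store; run.
apply: safe_step => b6; rewrite [step _ _]/=.
have xsE : out_tree Ls leaf = enc_seq (map fst xs).
  by rewrite /out_tree enc_seq_foldr /xs -map_comp.
rewrite /dfs_store -[guesses _ _ _ _ _]/Ls xsE.
apply: (@safe_test R M A M0 hA TA a K wr goal 1 [:: Assign 0 (Var (M + 12))] sa xs false true) => //.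
- move=> x; rewrite /xs => /List.in_map_iff[L' [<- hL']].
  by apply: hdec; apply: mem_List_In.
- move=> s' x10 x11 fb; apply: safe_step => b7; rewrite [step _ _]/=.
  apply: safe_halted => //.
  by rewrite /wr /accepting /= st_var /= /update eqxx; case: fb.
- by move=> _; rewrite /xs has_map /goal (guessesP tpos (leq_ceil p0 bE)).
Qed.

(** * Running time *)

Section Sizes.
Local Open Scope nat_scope.

Lemma size_enc_seq us : size us <= tree_size (enc_seq us).
Proof. elim: us => //= u us IH; lia. Qed.

Lemma tree_size_unary n : tree_size (enc_unary n) = (n.*2).+1.
Proof. elim: n => // n IH; rewrite enc_unaryS /= IH; lia. Qed.

Lemma size_enc_sets L s : s \in L -> size s <= tree_size (enc_sets L).
Proof.
elim: L => //= s' L IH; rewrite inE => /orP[/eqP ->|/IH h].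
  have := size_enc_seq (map enc_unary s'); rewrite size_map => h.
  by apply: leq_trans h _; apply: leqW; apply: leq_addr.
by apply: leq_trans h _; apply: leqW; apply: leq_addl.
Qed.

Lemma tree_size_enc_set N s : all (fun x => x < N) s ->
  tree_size (enc_seq (map enc_unary s)) <= (size s * (N.*2 + 2)).+1.
Proof.
elim: s => //= x s IH /andP[xN /IH]; rewrite tree_size_unary mulSn; lia.
Qed.

Lemma tree_size_enc_sets N Z L :
  all (all (fun x => x < N)) L -> all (fun s : seq nat => size s <= Z) L ->
  tree_size (enc_sets L) <= (size L * (Z * (N.*2 + 2) + 2)).+1.
Proof.

elim: L => //= s L IH /andP[sN LN] /andP[sZ LZ].
have h2 := IH LN LZ; have h1 := tree_size_enc_set sN.
have h3 : size s * (N.*2 + 2) <= Z * (N.*2 + 2) by rewrite leq_mul2r sZ orbT.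
rewrite ltnS mulSn; apply: leq_trans (leq_add h1 h2) _; lia.
Qed.

(** First the numeral of the universe size, at most m + p + 2, with some slack. Then the sets: at
    most m + 1 common ones and 2^p for each of at most m + 1 blocks, every list of length at most m
    + p + 3. *)
Definition guess_size (p m : nat) : nat :=
  (2 * m + 2 * p + 7) +
  (m + 1 + (m + 1) * 2 ^ p) * ((m + (p + 3)) * (2 * m + 2 * p + 6) + 2).

Lemma size_base_sets a L : size (base_sets a L) = (size L).+1.
Proof.
suff H acc : size (foldl (fun acc s => (a.+1 :: s) :: acc) acc L) = size L + size acc.
  by rewrite /base_sets H addn1.
by elim: L acc => //= s L IH acc; rewrite IH /= addnS.
Qed.

Lemma size_guess p b (I : hs_instance) m L : 0 < p ->
  b = (hs_n I + p.-1) %/ p ->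
  hs_n I <= m -> tree_size (enc_sets (hs_nat I)) <= m ->
  L \in hs_guesses p b I ->
  tree_size (node (enc_unary (p * b).+2) (enc_sets L)) <= guess_size p m.
Proof.
move=> p0 bE nm Lm LI.
have a_le : p * b <= m + p.
  by have := ceil_leq p0 bE; case: (b) => [|b'] /=; rewrite ?muln0 // mulnS; lia.
have b_le : b <= m + 1.
  have := ceil_leq p0 bE; have := leq_pmull b.-1 p0; lia.
have hlt := guesses_lt (leq_ceil p0 bE) LI.
(* Each block still to be guessed reserves 2^p sets. *)
have [hZ hL] : all (fun s : seq nat => size s <= m + (p + 3)) L /\
    size L + 0 * 2 ^ p <= m + 1 + b * 2 ^ p.
  apply: (guesses_ind (p := p) (R := p * b) (P := fun b' L =>
    all (fun s : seq nat => size s <= m + (p + 3)) L /\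
    size L + b' * 2 ^ p <= m + 1 + b * 2 ^ p)) LI => [b' d L' dp [h1 h2]|].
    split.
      rewrite all_cat h1 andbT; apply/allP => _ /mapP[c /combsP[sc _] ->].
      by rewrite /= sc; lia.
    apply: leq_trans h2; rewrite mulSn addnA leq_add2r size_cat addnC leq_add2l.
    by rewrite size_map (leq_trans (size_combs _ _)) // size_map size_iota.
  split; last first.
    rewrite size_base_sets leq_add2r addn1 ltnS.
    apply: leq_trans Lm; rewrite -(size_map (fun s => enc_seq (map enc_unary s))).
    exact: size_enc_seq.
  rewrite all_base_sets /=; apply/andP; split; first by lia.
  apply/allP => s /size_enc_sets h; apply: leq_ltn_trans h _; lia.
have := tree_size_enc_sets hlt hZ.
set t := tree_size (enc_sets L) => ht.
rewrite -[tree_size (node _ _)]/((tree_size (enc_unary (p * b).+2) + t).+1) tree_size_unary.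
have hb : size L <= m + 1 + (m + 1) * 2 ^ p.
  by apply: leq_trans (_ : m + 1 + b * 2 ^ p <= _); [lia|rewrite leq_add2l leq_mul2r b_le orbT].
have hW : (p * b).+2.*2 + 2 <= 2 * m + 2 * p + 6 by lia.
have hX : size L * ((m + (p + 3)) * ((p * b).+2.*2 + 2) + 2) <=
    (m + 1 + (m + 1) * 2 ^ p) * ((m + (p + 3)) * (2 * m + 2 * p + 6) + 2).
  by apply: leq_mul hb _; rewrite leq_add2r leq_mul2l hW orbT.
rewrite /guess_size; rewrite -ltnS in hX; move: (leq_trans ht hX).
move: (_ * ((m + (p + 3)) * _ + 2)) => X; lia.
Qed.

Lemma dfs_cost_le p b : dfs_cost p b <= (4 * p + 14) * b.+1 * p.+1 ^ b.
Proof.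
elim: b => [|b IH] /=; first by rewrite expn0 !muln1.
rewrite /dfs_cost1 in IH *.
have e1 : 0 < p.+1 ^ b.+1 by rewrite expn_gt0.
rewrite [_ * b.+2]mulnS mulnDl; apply: leq_add; first by rewrite leq_pmulr.
by rewrite expnS mulnCA leq_mul2l IH orbT.
Qed.

(** Arranged so that [p.+1 ^ b] and [TA] are the only quantities exponential in n; the other factors
    are polynomial in [m]. *)
Lemma hs_steps_le M p C TA n b nL nb m :
  n <= m -> b <= m + 1 -> nL <= m -> nb <= m ->
  hs_steps M p C TA n b nL nb <= p.+1 ^ b *
   ((m + 1) * 8 + m * 4 + m * (8 * m + 24) + (4 * p + 14) * (m + 2)
    + 2 * ((m + 2) * C) * (2 * M + 12) + 62
    + 2 * ((m + 2) * C) * TA).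
Proof.
move=> hn hb hL hnb; have e1 : 0 < p.+1 ^ b by rewrite expn_gt0.
set E := p.+1 ^ b in e1 *.
have h1 : b * 8 + nL * 4 + nb * (8 * n + 24) + 50 <=
    E * ((m + 1) * 8 + m * 4 + m * (8 * m + 24) + 50).
  apply: leq_trans (leq_pmull _ e1).
  rewrite leq_add2r leq_add ?leq_mul //; last lia.
  by rewrite leq_add ?leq_mul2r ?hb ?hL ?orbT.
have h2 : dfs_cost p b <= E * ((4 * p + 14) * (m + 2)).
  apply: leq_trans (dfs_cost_le p b) _; rewrite -/E [E * _]mulnC leq_mul2r.
  by apply/orP; right; rewrite leq_mul2l; apply/orP; right; lia.
have hK : b.+1 * C <= (m + 2) * C by rewrite leq_mul2r; apply/orP; right; lia.
have h3 : test_cost M TA (b.+1 * C) <=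
    2 * ((m + 2) * C) * (2 * M + 12) + 2 * ((m + 2) * C) * TA + 12.
  rewrite /test_cost /vote_cost leq_add2r -mulnDr -mul2n.
  by apply: leq_mul; [rewrite leq_mul2l hK|lia].
have h4 : E * test_cost M TA (b.+1 * C) <= E * (2 * ((m + 2) * C) * (2 * M + 12) + 2 * ((m + 2) * C) * TA + 12).
  by rewrite leq_mul2l h3 orbT.
rewrite /hs_steps -/E; move: (test_cost _ _ _) h4 (dfs_cost _ _) h2 => t h4 d h2.
by move: (nb * (8 * n + 24)) h1 => z h1; clear -h1 h2 h4; lia.
Qed.

End Sizes.

(** * Exponents *)

Section Exponents.
Variable R : realType.

(** Since (8/9)^6 <= 1/2, six factors gain one halving. *)
Lemma amplification (q : R) : exists C, (8 / 9) ^+ C * q <= 1 / 3.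
Proof.
have [q0|q0] := leP q 0; first by exists 0%N; rewrite expr0 mul1r; lra.
pose i := Num.bound (3 * q); exists (6 * i)%N.
have h : 3 * q < 2 ^+ i by apply: upper_nthrootP.
have h1 : (8 / 9) ^+ (6 * i) <= (2^-1) ^+ i :> R.
  rewrite exprM; apply: lerXn2r; rewrite ?nnegrE ?exprn_ge0 ?divr_ge0 //.
  by rewrite !exprS expr0; lra.
have h2 : (2^-1) ^+ i * 2 ^+ i = 1 :> R by rewrite -exprMn mulVf // expr1n.
have h3 : 0 < (2^-1) ^+ i :> R by rewrite exprn_gt0.
apply: (@le_trans _ _ ((2^-1) ^+ i * q)); first by rewrite ler_wpM2r // ltW.
by have := ler_wpM2l (ltW h3) (ltW h); rewrite h2; lra.
Qed.

(** With j >= 1 / eps and p = 4 j^2 one has eps p >= 4 j, while p + 1 <= (2 j + 1)^2 <= (2^(2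
    j))^2. *)
Lemma block_size (eps : R) : 0 < eps ->
  exists2 p, (0 < p)%N & p.+1%:R <= 2 `^ (eps * p%:R) :> R.
Proof.
move=> e0; pose j := (Num.trunc eps^-1).+1.
have ej : 1 <= eps * j%:R.
  have h : eps^-1 < j%:R by apply: truncnS_gt.
  by rewrite -ler_pdivrMl // mulr1 ltW.
exists (4 * j * j)%N; first by rewrite /j.
apply: (@le_trans _ _ (2 `^ (4 * j)%:R)); last first.
  rewrite ler_powR ?ler1n // [(4 * j * j)%:R]natrM mulrCA.
  by rewrite ler_peMr.
rewrite powR_mulrn // -natrX ler_nat.
have h : (2 * j < 2 ^ (2 * j))%N by apply: ltn_expl.
have -> : (4 * j = 2 * j + 2 * j)%N by lia.
by rewrite expnD; apply: leq_trans (leq_mul h h); lia.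
Qed.

Lemma error_probE (P : problem) (A : cmd) (I : instance P) T :
  error_prob R A I T = err R (fun s => accepting s != answer I) T (init A (encode I)).
Proof. exact: (err_count R (fun s => accepting s != answer I)). Qed.

Lemma leq_horner (P : {poly nat}) x y : (x <= y)%N -> (P.[x] <= P.[y])%N.
Proof.
move=> xy; elim/poly_ind: P => [|P a IH]; first by rewrite !horner0.
by rewrite !hornerD !hornerM !hornerX !hornerC leq_add2r; apply: leq_mul.
Qed.

Lemma hitting_set_of_set_splitting k (eps : R) : 0 < eps ->
  exists k', forall e : R, 0 < e ->
    solvable_with_exponent (set_splitting k') e ->
    solvable_with_exponent (hitting_set k) (e + eps).
Proof.
move=> eps0; have [p p0 hp] := block_size eps0.
exists (k + p + 2)%N => e e0 [A [P hA]].
have [C hC] := amplification p.+1%:R.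
have [M hM] := cmd_below_ex A.
(* The instances have p b + 2 <= n + p + 2 elements; [c] absorbs the factor 2^(e (p + 2)). *)
pose c := (Num.trunc (2 `^ (e * (p + 2)%:R) : R)).+1.
have hc : 2 `^ (e * (p + 2)%:R) <= c%:R :> R by rewrite ltW // truncnS_gt.
(* [S], [Q1] and [Q2] transcribe [guess_size] and the bound of [hs_steps_le] as polynomials in
   [m]. *)
pose S : {poly nat} := 2%N%:P * 'X + (2 * p)%N%:P + 7%N%:P +
  ('X + 1%N%:P + ('X + 1%N%:P) * (2 ^ p)%N%:P) *
    (('X + (p + 3)%N%:P) * (2%N%:P * 'X + (2 * p)%N%:P + 6%N%:P) + 2%N%:P).
have SE m : S.[m] = guess_size p m.
  by rewrite /S !(hornerD, hornerM, hornerC, hornerX).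
pose Q1 : {poly nat} := ('X + 1%N%:P) * 8%N%:P + 'X * 4%N%:P + 'X * (8%N%:P * 'X + 24%N%:P)
  + (4 * p + 14)%N%:P * ('X + 2%N%:P) + 2%N%:P * (('X + 2%N%:P) * C%:P) * (2 * M.+1 + 12)%N%:P + 62%N%:P.
pose Q2 : {poly nat} := 2%N%:P * (('X + 2%N%:P) * C%:P).
exists (hs_prog M.+1 p C A), (p.+1%N%:P * (Q1 + Q2 * (c%:P * (P \Po S)))) => I legalI.
set m := input_size I; set n := param I.
pose b := ((hs_n I + p.-1) %/ p)%N.
have [nm [Lm bm]] : (hs_n I <= m)%N /\ (tree_size (enc_sets (hs_nat I)) <= m)%N /\
   (size (bits_of_nat `|hs_t I|%N) <= m)%N.
  rewrite /m /input_size [encode I]/= enc_family_nat.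
  have h1 := tree_size_unary (hs_n I).
  have h2 := size_enc_seq (map enc_bool (bits_of_nat `|hs_t I|%N)).
  by rewrite size_map in h2; rewrite /enc_int /= h1; lia.
have Lm' : (size (hs_nat I) <= m)%N.
  apply: leq_trans Lm; rewrite -(size_map (fun s => enc_seq (map enc_unary s))).
  exact: size_enc_seq.
have pb : (p * b <= hs_n I + p)%N.
  by have := ceil_leq p0 (erefl b); case: (b) => [|b'] /=; rewrite ?muln0 // mulnS; lia.
have bm' : (b <= m + 1)%N.
  have := ceil_leq p0 (erefl b); have := leq_pmull b.-1 p0; lia.
pose Y : R := 2 `^ (e * n%:R).
have Y1 : 1 <= Y by rewrite /Y -[leLHS](powRr0 2) ler_powR ?ler1n // mulr_ge0 // ltW.
(* One time bound for all guesses, for the analysis only: the program never computes it, since [A]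
   halts by itself on legal instances. *)
pose TA := Num.trunc (Y * (c * P.[S.[m]])%N%:R).
have TAle : TA%:R <= Y * (c * P.[S.[m]])%N%:R.
  by rewrite /TA truncn_le mulr_ge0 // (le_trans ler01).
have hdec L : L \in hs_guesses p b I -> decides R A TA (p * b) (enc_sets L)
    (has_splitting (family_of (ss_sets (ss_of (p * b) L)))).
  move=> LI; have legalJ := guesses_legal legalI LI.
  have [T [hT hlt herr]] := hA _ legalJ.
  have encJ : encode (ss_of (p * b) L : instance (set_splitting (k + p + 2))) =
      node (enc_unary (p * b).+2) (enc_sets L).
    by apply: encode_ss_of; apply: guesses_lt LI; apply: leq_ceil.
  rewrite error_probE encJ in herr.
  have {}hlt : halts T (init A (node (enc_unary (p * b).+2) (enc_sets L))).
    by apply/haltsP => r; rewrite -encJ; apply: hlt.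
  suff le_T : (T <= TA)%N.
    rewrite /decides -(subnKC le_T).
    have [h1 h2] := halts_err_add R (fun s => accepting s != has_splitting (family_of (ss_sets (ss_of (p * b) L))))
      (TA - T) hlt.
    by split => //; rewrite h2.
  rewrite /TA truncn_ge_nat; last by rewrite mulr_ge0 // (le_trans ler01).
  apply: le_trans hT _; rewrite natrM mulrA ler_pM ?ler0n ?powR_ge0 //.
    apply: (@le_trans _ _ (2 `^ (e * n%:R + e * (p + 2)%:R))).
      rewrite ler_powR ?ler1n // -mulrDr ler_wpM2l ?(ltW e0) // -natrD ler_nat.
      change ((p * b).+2 <= hs_n I + (p + 2))%N.
      by rewrite addnA addn2 !ltnS.
    rewrite powRD; last by rewrite pnatr_eq0 implybT.
    by rewrite ler_wpM2l ?powR_ge0.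
  rewrite ler_nat leq_horner // SE /input_size encJ.
  by apply: (size_guess (I := I)) => //; rewrite /m.
have := @safe_hs_prog R M.+1 p C TA b A I isT hM p0 erefl hC hdec.
set T := hs_steps _ _ _ _ _ _ _ _ => -[hT eT].
exists T; split; last by rewrite error_probE.
  have := @hs_steps_le M.+1 p C TA _ _ _ _ m nm bm' Lm' bm; rewrite -/T.
  set E := (p.+1 ^ b)%N; set Q0 := (X in (E * (X + _))%N) => hTn.
  have EE : E%:R <= p.+1%:R * 2 `^ (eps * n%:R) :> R.
    (* Only b - 1 blocks are sure to fit into n elements; the last one costs the constant factor p +
       1. *)
    apply: (@le_trans _ _ (p.+1%:R * p.+1%:R ^+ b.-1)).
      rewrite -natrX -natrM ler_nat /E -expnS leq_exp2l //; exact: leqSpred.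
    rewrite ler_wpM2l // (@le_trans _ _ ((2 `^ (eps * p%:R)) ^+ b.-1)) //.
      by apply: lerXn2r; rewrite ?nnegrE ?powR_ge0.
    rewrite -powR_mulrn ?powR_ge0 // -powRrM ler_powR ?ler1n //.
    rewrite -mulrA ler_wpM2l ?(ltW eps0) // -natrM ler_nat.
    exact: ceil_leq p0 erefl.
  have QE : (p.+1%:P * (Q1 + Q2 * (c%:P * (P \Po S)))).[m] =
      (p.+1 * (Q0 + 2 * ((m + 2) * C) * (c * P.[S.[m]])))%N.
    by rewrite /Q1 /Q2 !(hornerD, hornerM, hornerC, hornerX, horner_comp).
  rewrite QE; move: {QE} Q0 (2 * _)%N (c * _)%N TAle hTn => Q0 q G TAle hTn.
  rewrite mulrDl powRD; last by rewrite pnatr_eq0 implybT.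
  rewrite -/Y; set X := 2 `^ (eps * n%:R) in EE *.
  have X0 : 0 <= X by rewrite powR_ge0.
  apply: (@le_trans _ _ (E%:R * (Q0%:R + q%:R * TA%:R))).
    by rewrite -natrM -natrD -natrM ler_nat.
  rewrite natrM natrD [(q * G)%:R]natrM.
  apply: (@le_trans _ _ (p.+1%:R * X * (Y * (Q0%:R + q%:R * G%:R)))); last by rewrite le_eqVlt; apply/orP; left; apply/eqP; ring.
  apply: ler_pM => //.
  rewrite mulrDr lerD //; first by rewrite ler_peMl.
  by rewrite mulrCA ler_wpM2l.
by move=> r; apply/haltsP: r.
Qed.

End Exponents.

(** * Monotonicity in k and passage to the limit *)

Local Open Scope ereal_scope.

Lemma sets_of_size_leqW n k (F : {set {set 'I_n}}) :
  sets_of_size_at_most k F -> sets_of_size_at_most k.+1 F.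
Proof.
move=> /forallP h; apply/forallP => S; apply/implyP => SF.
by move: (h S) => /implyP/(_ SF)/leqW.
Qed.

(** Raising k only adds legal instances and changes neither encoding nor parameter, so fewer
    exponents are achievable and the infimum grows. *)
Lemma sigma_hitting_set_nd (R : realType) :
  {homo (fun k => sigma R (hitting_set k)) : i j / (i <= j)%N >-> i <= j}.
Proof.
apply/nondecreasing_seqP => k; apply: ereal_inf_le_tmp.
move=> _ [e [e0 [A [P h]]] <-]; exists e => //; split=> //.
by exists A, P => I /sets_of_size_leqW; apply: (h I).
Qed.

Lemma sigma_set_splitting_nd (R : realType) :
  {homo (fun k => sigma R (set_splitting k)) : i j / (i <= j)%N >-> i <= j}.
Proof.
apply/nondecreasing_seqP => k; apply: ereal_inf_le_tmp.
move=> _ [e [e0 [A [P h]]] <-]; exists e => //; split=> //.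
by exists A, P => I /sets_of_size_leqW; apply: (h I).
Qed.

Lemma sigma_ge0 (R : realType) P : 0 <= sigma R P.
Proof.
apply: le_ereal_inf_tmp => _ [e [e0 _] <-].
by rewrite lee_fin ltW.
Qed.

Theorem theorem8 (R : realType) :
  [/\ cvgn (fun k : nat => sigma R (hitting_set k)),
      cvgn (fun k : nat => sigma R (set_splitting k))
    & limn (fun k : nat => sigma R (hitting_set k))
      <= limn (fun k : nat => sigma R (set_splitting k))].
Proof.
have cvHS := ereal_nondecreasing_is_cvgn (@sigma_hitting_set_nd R).
have cvSS := ereal_nondecreasing_is_cvgn (@sigma_set_splitting_nd R).
split=> //; apply: lime_le => //; apply: nearW => k.
have leL j : sigma R (set_splitting j) <= limn (fun k => sigma R (set_splitting k)).
  rewrite (cvg_lim _ (ereal_nondecreasing_cvgn (@sigma_set_splitting_nd R))) //.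
  by apply: ereal_sup_ubound; exists j.
set L := limn _ in leL *.
apply/lee_addgt0Pr => eps eps0.
(* One half of [eps] pays for the reduction, the other for the excess of [e] over the infimum. *)
have eps2 : (0 < eps / 2)%R by rewrite divr_gt0.
have [k' hk'] := hitting_set_of_set_splitting k eps2.
(* An infinite limit leaves nothing to prove, and [-oo] is excluded by [sigma_ge0]. *)
case: L leL => [l| |] leL; last 2 first.
- by rewrite leey.
- by have := le_trans (sigma_ge0 R (set_splitting 0)) (leL 0%N); rewrite leNgt ltNy0.
have : sigma R (set_splitting k') < (l + eps / 2)%:E.
  by rewrite (le_lt_trans (leL k')) // lte_fin ltrDl.
case/ereal_inf_lt => _ [e [e0 he] <-]; rewrite lte_fin => el.
apply: (@le_trans _ _ (e + eps / 2)%:E).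
  apply: ereal_inf_lbound; exists (e + eps / 2)%R => //; split; first exact: addr_gt0.
  exact: hk'.
by rewrite -EFinD lee_fin; lra.
Qed.
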